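(* Let $\mu$ be a compound Poisson distribution on $\mathbb R_+=[0,\infty)$ with absolutely continuous Lévy measure $\nu(dx)=\lambda\phi(x)\,dx$, where $\lambda:=\nu((0,\infty))\in(0,\infty)$ and $\phi$ is a probability density function on $\mathbb R_+$. Let $$p(x):=(e^{\lambda}-1)^{-1}\sum_{n=1}^{\infty}\frac{\lambda^n}{n!}\phi^{n\otimes}(x),$$ so that $\mu(dx)=e^{-\lambda}\delta_0(dx)+(1-e^{-\lambda})p(x)\,dx$. Consider the following assertions: (a) $p\in\mathcal S_d$. (b) $\phi\in\mathcal S_d$. (c) $\phi\in\mathcal L_d$ and $(1-e^{-\lambda})p(x)\sim\lambda\phi(x)$. (d) $\phi\in\mathcal L_d$ and there is $C\in(0,\infty)$ such that $p(x)\sim C\phi(x)$. Then: (i) Assertion (a) implies (b). (ii) Assertions (c) and (d) are equivalent, and (c) implies (a). (iii) If $\int_0^\infty(\phi(x))^2dx<\infty$, then (b) implies (c). Thus, under the assumption that $\int_0^\infty(\phi(x))^2dx<\infty$, all assertions (a)-(d) are equivalent.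
   Context: A probability density function is a nonnegative measurable function with integral $1$; a density on $\mathbb R_+$ is regarded as a density on $\mathbb R$ vanishing on $(-\infty,0)$. Densities are treated as pointwise defined functions. $f\otimes g(x)=\int f(x-u)g(u)\,du$ is the convolution (a nonnegative, possibly infinite, Lebesgue integral), and $f^{n\otimes}$ is the $n$-th convolution power ($f^{1\otimes}=f$). For functions $f_1,g_1$ that are positive on some $[A,\infty)$, $f_1(x)\sim g_1(x)$ means $\lim_{x\to\infty}f_1(x)/g_1(x)=1$. A nonnegative measurable function $g$ on $\mathbb R$ is in the class $\mathbf L$ (long-tailed) if $g(x+a)\sim g(x)$ for every $a\in\mathbb R$ (in particular $g$ is eventually positive). A probability density $g$ on $\mathbb R$ is in $\mathcal L_d$ if $g\in\mathbf L$. A probability density $g$ on $\mathbb R$ is in $\mathcal S_d$ (subexponential density) if $g\in\mathcal L_d$ and $g^{2\otimes}(x)\sim 2g(x)$. $\delta_0$ denotes the delta measure at $0$. The compound Poisson distribution with finite Lévy measure $\nu=\lambda\phi(x)dx$ is $\mu=e^{-\lambda}\sum_{n\ge0}\frac{\lambda^n}{n!}(\phi(x)dx)^{n*}$, with the $0$-th convolution power equal to $\delta_0$. *)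

(* Defs.v *)
From mathcomp Require Import all_boot all_order all_algebra.
From mathcomp Require Import all_classical all_reals all_analysis.
From mathcomp Require Import measurable_realfun.
Import Order.TTheory GRing.Theory Num.Theory.
Import numFieldNormedType.Exports.

Set Implicit Arguments.
Unset Strict Implicit.
Unset Printing Implicit Defensive.

Local Open Scope classical_set_scope.
Local Open Scope ring_scope.
Local Open Scope ereal_scope.

(* A density takes finite values, but a convolution of densities may be infinite
   at some points, so the classes of functions below are defined for functions
   with values in [\bar R]; a density [phi : R -> R] enters them as
   [EFin \o phi]. *)

Section asymptotics.
Context {R : realType}.
Implicit Types f g : R -> \bar R.

(* The ratio is meaningful only where both functions are finite, hence the
   finiteness requirement next to the eventual positivity. *)
Definition asym_equiv f g : Prop :=
  (exists A : R, forall x : R, (A <= x)%R ->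
     (0 < f x < +oo) /\ (0 < g x < +oo)) /\
  (fine (f x) / fine (g x))%R @[x --> +oo%R] --> (1 : R)%R.

Definition nonneg_measurable g : Prop :=
  measurable_fun [set: R] g /\ (forall x, 0 <= g x).

Definition prob_density g : Prop :=
  nonneg_measurable g /\ \int[@lebesgue_measure R]_x g x = 1.

Definition class_L g : Prop :=
  nonneg_measurable g /\
  forall a : R, asym_equiv (fun x => g (x + a)%R) g.

Definition class_Ld g : Prop := prob_density g /\ class_L g.

Definition fconv f g : R -> \bar R :=
  fun x => \int[@lebesgue_measure R]_u (f (x - u)%R * g u).

(* Meant for [0 < n]: the first power is [f] and the [n.+1]-st is
   [fconv f (fconv_power f n)] when [0 < n]. *)
Definition fconv_power f (n : nat) : R -> \bar R := iter n.-1 (fconv f) f.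

Definition class_Sd g : Prop :=
  class_Ld g /\ asym_equiv (fconv_power g 2) (fun x => 2%:E * g x).

End asymptotics.

Section compound_poisson.
Context {R : realType}.
Implicit Types m : set (measurableTypeR R) -> \bar R.

(* The set function [f(x) dx]. *)
Definition ac_measure (f : R -> \bar R) (A : set (measurableTypeR R)) : \bar R :=
  \int[@lebesgue_measure R]_(x in A) f x.

(* Convolution of measures: the image of the product measure under addition. *)
Definition mconv m1 m2 : set (measurableTypeR R) -> \bar R :=
  pushforward (m1 \x m2)
    (fun z : measurableTypeR R * measurableTypeR R =>
       ((z.1 : R) + (z.2 : R))%R : measurableTypeR R).

Definition mconv_power m (n : nat) : set (measurableTypeR R) -> \bar R :=
  iter n (mconv m) \d_(0%R : measurableTypeR R).

(* The compound Poisson distribution with Levy measure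
   [lambda * phi(x) dx]. *)
Definition compound_poisson (lambda : R) (phi : R -> R)
    (A : set (measurableTypeR R)) : \bar R :=
  (expR (- lambda))%:E *
  \sum_(0 <= n <oo)
    ((lambda ^+ n / n`!%:R)%:E * mconv_power (ac_measure (EFin \o phi)) n A).

(* The normalized density of the absolutely continuous part. *)
Definition cp_density (lambda : R) (phi : R -> R) (x : R) : \bar R :=
  ((expR lambda - 1)^-1)%:E *
  \sum_(1 <= n <oo)
    ((lambda ^+ n / n`!%:R)%:E * fconv_power (EFin \o phi) n x).

End compound_poisson.

(* Main.v *)
(* Write [q = exp(lambda phi) - 1], a multiple of [p]. Multiplication by [x] is a
   derivation of the convolution algebra, hence the pointwise identity
   [x q = lambda (x phi) + lambda (x phi) * q]; divided by [x] it expresses [q]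
   through a single convolution in which only [phi(x - u)] with bounded [u] and the
   middle range [A <= u <= x - A] matter, because the weight [1 - u / x] kills the
   range [u >= x - A].

   (d) => (c), (a): if [q ~ C phi], the identity shows that
   [J = lim_A lim_x int_A^(x-A) phi(x-u) phi(u) du / phi(x)] exists. Computing
   [phi * phi * phi] directly and through [x phi^3 = 3 (x phi) * phi^2] yields
   [J^2 = 3/2 J^2], so [J = 0] and [C = lambda e^lambda].

   (a) => (b): since [lambda phi <= q], the middle range is negligible and
   [rho = lambda phi / q <= 1] satisfies [rho + rho * q --> 1], that is
   [exp(lambda phi) * rho --> 1]. Applying the signed series of [exp(- lambda phi)]
   to this bounded function gives [rho --> e^(-lambda)].

   (iii): square integrability makes every [phi^n], [n >= 2], bounded, which yields
   Kesten's bound [phi^n <= K 5^n phi] near infinity, hence [q = O(phi)]; the middle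
   range is then negligible and the identity gives [q ~ lambda e^lambda phi]. *)

Require Import Defs.
From HB Require Import structures.
From mathcomp Require Import all_boot all_order all_algebra.
From mathcomp Require Import all_classical all_reals all_analysis.
From mathcomp Require Import measurable_realfun.
From mathcomp Require Import ring lra.
Import Order.TTheory GRing.Theory Num.Theory.
Import numFieldNormedType.Exports.

Local Open Scope classical_set_scope.
Local Open Scope ring_scope.
Local Open Scope ereal_scope.

(** * The convolution algebra on the half-line *)

Section convolution.
Context {R : realType}.
Local Notation mu := (@lebesgue_measure R).
Implicit Types f g h : R -> \bar R.

(** The obstacle is that [phi] may be locally unbounded: its powers need not be bounded, or even
    finite, on compact sets, so term by term limits in the series for [q] have no dominating bound
    unless [phi] is square integrable. The identity for [x q] avoids the series, since [q] enters
    through one convolution only. The range [u >= x - A] dies because there [q] is compared with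
    [x q], while [x phi] is integrable on bounded windows even if its mean is infinite. The factor
    [3/2] comes from symmetry: on the middle range of [phi * phi] the weight [1 - u / x] averages to
    [1/2], and the power rule multiplies it by 3. The constant [lambda e^lambda] is [lambda] plus
    [lambda] times the mass [e^lambda - 1] of [q]. In (a) => (b) nothing is known about the tail of
    [phi], so [q] is the reference function. The bound [rho <= 1] then makes the part of [rho * q]
    outside a window small without any middle range estimate, and makes truncation errors of
    exponential series uniform in [x]. *)

Lemma integral_translate f (a : R) : nonneg_measurable f ->
  \int[mu]_x f (x + a)%R = \int[mu]_x f x.
Proof.
move=> [mf f0].
have msh : measurable_fun setT ((fun x : R => x + a)%R : measurableTypeR R -> measurableTypeR R).
  exact: measurable_funD.
have E (A : set R) : measurable A ->
    pushforward mu ((fun x : R => x + a)%R : _ -> measurableTypeR R) A = mu A.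
  move=> mA; apply/esym/lebesgue_measure_unique => //= _ [[b c]] _ <-.
  rewrite /pushforward [X in _ = mu X](_ : _ = `](b - a)%R, (c - a)%R]%classic); last first.
    by apply/seteqP; split => x /=; rewrite !in_itv/= ltrBlDr lerBrDr.
  rewrite !lebesgue_measure_itv/= !lte_fin ltrD2r; case: ifP => // _.
  by rewrite !EFinN -!EFinD; congr EFin; lra.
rewrite (_ : \int[mu]_x f (x + a)%R = \int[pushforward mu
  ((fun x : R => x + a)%R : measurableTypeR R -> measurableTypeR R)]_x f x).
  by apply: eq_measure_integral => A mA _; exact: E.
by rewrite ge0_integral_pushforward.
Qed.

Lemma integral_reflect f (a : R) : nonneg_measurable f ->
  \int[mu]_x f (a - x)%R = \int[mu]_x f x.
Proof.
move=> [mf f0].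
have mN : measurable_fun setT (-%R : measurableTypeR R -> measurableTypeR R).
  exact: oppr_measurable.
rewrite -[RHS](integral_translate f a)//.
transitivity (\int[pushforward mu (-%R : measurableTypeR R -> measurableTypeR R)]_x f (x + a)%R).
  rewrite ge0_integral_pushforward//=.
  - by apply: eq_integral => x _ /=; rewrite addrC.
  - by apply: (measurableT_comp mf); exact: measurable_funD.
by apply: eq_measure_integral => A mA _; exact: lebesgue_measureN.
Qed.
End convolution.

Section convolution_algebra.
Context {R : realType}.
Local Notation mu := (@lebesgue_measure R).
Local Notation T := (measurableTypeR R).
Implicit Types f g h : R -> \bar R.

Lemma integral_setE f (A : set T) : measurable A ->
  \int[mu]_(x in A) f x = \int[mu]_x (f x * (\1_A x)%:E).
Proof. by move=> mA; rewrite integral_mkcond epatch_indic. Qed.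

Lemma measurable_conv_kernel f g : measurable_fun setT f -> measurable_fun setT g ->
  measurable_fun setT (fun z : T * T => f (z.1 - z.2)%R * g z.2).
Proof.
move=> mf mg; apply: emeasurable_funM.
  apply: (measurableT_comp mf) => /=.
  by apply: measurable_funB; [exact: measurable_fst|exact: measurable_snd].
by apply: (measurableT_comp mg); exact: measurable_snd.
Qed.

Lemma measurable_reflect f (x : R) : measurable_fun setT f ->
  measurable_fun setT (fun u : R => f (x - u)%R).
Proof. by move=> mf; apply: (measurableT_comp mf); exact: measurable_funB. Qed.

Lemma nonneg_measurable_reflect f (x : R) : nonneg_measurable f ->
  nonneg_measurable (fun u : R => f (x - u)%R).
Proof. by move=> [mf f0]; split=> //; exact: measurable_reflect. Qed.

Lemma nonneg_measurableM f g : nonneg_measurable f -> nonneg_measurable g ->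
  nonneg_measurable (fun u : R => f u * g u).
Proof.
move=> [mf f0] [mg g0]; split; first exact: emeasurable_funM.
by move=> x; exact: mule_ge0.
Qed.

Lemma fconv_nonneg_measurable f g : nonneg_measurable f -> nonneg_measurable g ->
  nonneg_measurable (fconv f g).
Proof.
move=> [mf f0] [mg g0]; split; last first.
  by move=> x; apply: integral_ge0 => u _; exact: mule_ge0.
apply: (measurable_fun_fubini_tonelli_F (m2 := mu)
  (fun z : T * T => f (z.1 - z.2)%R * g z.2)).
  exact: measurable_conv_kernel.
by move=> z; exact: mule_ge0.
Qed.

Lemma fconvC f g : nonneg_measurable f -> nonneg_measurable g ->
  fconv f g = fconv g f.
Proof.
move=> nf ng; apply/funext => x; rewrite /fconv.
rewrite -(integral_reflect _ x); last first.
  by apply: nonneg_measurableM => //; exact: nonneg_measurable_reflect.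
by apply: eq_integral => u _; rewrite subKr muleC.
Qed.

Lemma integral_fconv f g : nonneg_measurable f -> nonneg_measurable g ->
  \int[mu]_x fconv f g x = (\int[mu]_x f x) * (\int[mu]_x g x).
Proof.
move=> nf ng; have [[mf f0] [mg g0]] := (nf, ng); rewrite /fconv.
rewrite (fubini_tonelli (fun z : T * T => f (z.1 - z.2)%R * g z.2)).
- rewrite -ge0_integralZl//; last exact: integral_ge0.
  apply: eq_integral => u _ /=.
  rewrite ge0_integralZr//.
  + by rewrite integral_translate.
  + by apply: (measurableT_comp mf); exact: measurable_funD.
- exact: measurable_conv_kernel.
- by move=> z; exact: mule_ge0.
Qed.

Lemma fconvA f g h : nonneg_measurable f -> nonneg_measurable g ->
  nonneg_measurable h -> fconv f (fconv g h) = fconv (fconv f g) h.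
Proof.
move=> nf ng nh; have [[mf f0] [mg g0] [mh h0]] := And3 nf ng nh.
apply/funext => x.
transitivity (\int[mu]_u \int[mu]_v (f (x - u)%R * g (u - v)%R * h v)).
  apply: eq_integral => u _; rewrite /fconv -ge0_integralZl//.
  - by apply: eq_integral => v _; rewrite muleA.
  - by apply: emeasurable_funM => //; exact: measurable_reflect.
  - by move=> v _; exact: mule_ge0.
rewrite (fubini_tonelli (fun z : T * T => f (x - z.1)%R * g (z.1 - z.2)%R * h z.2)).
- apply: eq_integral => v _ /=; rewrite ge0_integralZr//.
  + congr (_ * _); rewrite /fconv -[RHS](integral_translate _ (- v)%R); last first.
      by apply: nonneg_measurableM => //; exact: nonneg_measurable_reflect.
    by apply: eq_integral => u _ /=; rewrite opprD opprK addrA addrAC subrK.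
  + apply: emeasurable_funM; first exact: measurable_reflect.
    by apply: (measurableT_comp mg); exact: measurable_funD.
  + by move=> u _; exact: mule_ge0.
- apply: emeasurable_funM; last by apply: (measurableT_comp mh); exact: measurable_snd.
  apply: emeasurable_funM.
  + apply: (measurableT_comp mf); apply: measurable_funB; first exact: measurable_cst.
    exact: measurable_fst.
  + apply: (measurableT_comp mg); apply: measurable_funB; first exact: measurable_fst.
    exact: measurable_snd.
- by move=> z; apply: mule_ge0 => //; exact: mule_ge0.
Qed.

Lemma fconvZr (k : R) f g : (0 <= k)%R -> nonneg_measurable f -> nonneg_measurable g ->
  fconv f (fun x => k%:E * g x) = fun x => k%:E * fconv f g x.
Proof.
move=> k0 nf [mg g0]; apply/funext => x; rewrite /fconv.
have [mfx fx0] := nonneg_measurable_reflect f x nf.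
rewrite -ge0_integralZl_EFin//.
- by apply: eq_integral => u _; rewrite muleCA.
- by move=> u _; exact: mule_ge0.
- exact: emeasurable_funM.
Qed.

Lemma nneseries_nonneg_measurable (F : nat -> R -> \bar R) :
  (forall n, nonneg_measurable (F n)) ->
  nonneg_measurable (fun x => \sum_(0 <= n <oo) F n x).
Proof.
move=> nF; split; last by move=> x; apply: nneseries_ge0 => n _ _; exact: (nF n).2.
by apply: ge0_emeasurable_sum => [n x _ _|n _]; [exact: (nF n).2|exact: (nF n).1].
Qed.

(** The factor [k] may be [+oo], as a value of a convolution can be; the series is read as an
    integral against the counting measure. *)
Lemma ge0_nneseriesZl (k : \bar R) (a : nat -> \bar R) : 0 <= k -> (forall n, 0 <= a n) ->
  \sum_(0 <= n <oo) (k * a n) = k * \sum_(0 <= n <oo) a n.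
Proof.
move=> k0 a0; rewrite -!ge0_integral_count//; last by move=> n; exact: mule_ge0.
by rewrite ge0_integralZl.
Qed.

Lemma fconv_nneseriesr f (F : nat -> R -> \bar R) : nonneg_measurable f ->
  (forall n, nonneg_measurable (F n)) ->
  fconv f (fun x => \sum_(0 <= n <oo) F n x) = fun x => \sum_(0 <= n <oo) fconv f (F n) x.
Proof.
move=> nf nF; apply/funext => x; rewrite /fconv.
have [mfx fx0] := nonneg_measurable_reflect f x nf.
rewrite -integral_nneseries//.
- apply: eq_integral => u _; rewrite -ge0_nneseriesZl//.
  by move=> n; exact: (nF n).2.
- by move=> n; apply: emeasurable_funM => //; exact: (nF n).1.
- by move=> n u _; apply: mule_ge0 => //; exact: (nF n).2.
Qed.
End convolution_algebra.

Section half_line.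
Context {R : realType}.
Local Notation mu := (@lebesgue_measure R).
Implicit Types f g h : R -> \bar R.

(** Support in the half-line keeps [x f(x)] nonnegative, so multiplication by [x] stays among
    functions whose Lebesgue integral needs no integrability condition. *)
Definition causal f := nonneg_measurable f /\ forall x : R, (x < 0)%R -> f x = 0.

Definition mulid f : R -> \bar R := fun x => x%:E * f x.

Lemma causal_mulid f : causal f -> causal (mulid f).
Proof.
move=> [[mf f0] fN]; split; last by move=> x x0; rewrite /mulid fN ?mule0.
split; first by apply: emeasurable_funM => //; exact/measurable_EFinP.
move=> x; rewrite /mulid; have [x0|x0] := ltP x 0%R; first by rewrite fN ?mule0.
by rewrite mule_ge0.
Qed.

Lemma causal_fconv f g : causal f -> causal g -> causal (fconv f g).
Proof.
move=> [nf fN] [ng gN]; split; first exact: fconv_nonneg_measurable.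
move=> x x0; apply: integral0_eq => u _.
have [u0|u0] := ltP u 0%R; first by rewrite gN ?mule0.
by rewrite fN ?mul0e// subr_lt0 (lt_le_trans x0).
Qed.

Lemma causalZ (k : R) f : (0 <= k)%R -> causal f -> causal (fun x => k%:E * f x).
Proof.
move=> k0 [[mf f0] fN]; split; last by move=> x x0; rewrite fN// mule0.
by split => [|x]; [exact: measurable_funeM|exact: mule_ge0].
Qed.

(** Under the integral, [x = (x - u) + u]. By causality both summands are nonnegative wherever the
    integrand is nonzero, as distributivity in [\bar R] demands. *)
Lemma mulid_fconv f g : causal f -> causal g ->
  mulid (fconv f g) = fconv (mulid f) g \+ fconv f (mulid g).
Proof.
move=> cf cg; have [[[mf f0] fN] [[mg g0] gN]] := (cf, cg).
have [cDf cDg] := (causal_mulid f cf, causal_mulid g cg).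
apply/funext => x /=; have [x0|x0] := ltP x 0%R.
  by rewrite /mulid !(causal_fconv _ _ _ _).2 ?mule0 ?adde0.
have [mfx fx0] := nonneg_measurable_reflect f x cf.1.
have [mDfx Dfx0] := nonneg_measurable_reflect (mulid f) x cDf.1.
rewrite /mulid /fconv -ge0_integralZl_EFin//; first last.
- exact: emeasurable_funM.
- by move=> u _; exact: mule_ge0.
rewrite -ge0_integralD//; first last.
- by apply: emeasurable_funM => //; exact: cDg.1.1.
- by move=> u _; apply: mule_ge0 => //; exact: cDg.1.2.
- exact: emeasurable_funM.
- by move=> u _; apply: mule_ge0 => //; exact: Dfx0.
apply: eq_integral => u _; have [u0|u0] := ltP u 0%R.
  by rewrite gN ?mule0 ?adde0.
have [xu|xu] := ltP (x - u)%R 0%R; first by rewrite fN// ?(mule0,mul0e) ?adde0.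
rewrite -{1}(subrK u x) EFinD ge0_muleDl ?lee_fin//.
by rewrite -muleA; congr (_ + _); rewrite muleCA.
Qed.

Lemma fconv_powerS f n : fconv_power f n.+2 = fconv f (fconv_power f n.+1).
Proof. by []. Qed.

Lemma causal_fconv_power f n : causal f -> causal (fconv_power f n.+1).
Proof.
by move=> cf; elim: n => [//|n ih]; rewrite fconv_powerS; exact: causal_fconv.
Qed.

Lemma integral_fconv_power f n : causal f -> \int[mu]_x f x = 1 ->
  \int[mu]_x fconv_power f n.+1 x = 1.
Proof.
move=> cf f1; elim: n => [//|n ih].
rewrite fconv_powerS integral_fconv ?f1 ?mul1e ?ih//; first exact: cf.1.
exact: (causal_fconv_power _ n cf).1.
Qed.

(** The power rule for a derivation of a commutative algebra. It starts at the second power because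
    the zeroth one, the delta at 0, is not a function. *)
Lemma mulid_fconv_power f n : causal f ->
  mulid (fconv_power f n.+2) = fun x => n.+2%:R%:E * fconv (mulid f) (fconv_power f n.+1) x.
Proof.
move=> cf; have cDf := causal_mulid f cf; elim: n => [|n ih].
  rewrite fconv_powerS mulid_fconv// [fconv f (mulid f)]fconvC; [|exact: cf.1|exact: cDf.1].
  by apply/funext => x; rewrite /= mule_natl mule2n.
have cP k := causal_fconv_power f k cf.
rewrite fconv_powerS mulid_fconv// ih fconvZr//; [|exact: cf.1|]; last first.
  by apply: fconv_nonneg_measurable; [exact: cDf.1|exact: (cP n).1].
rewrite fconvA; [|exact: cf.1|exact: cDf.1|exact: (cP n).1].
rewrite [fconv f (mulid f)]fconvC; [|exact: cf.1|exact: cDf.1].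
rewrite -fconvA; [|exact: cDf.1|exact: cf.1|exact: (cP n).1].
by apply/funext => x; rewrite /= !mule_natl -fconv_powerS muleS.
Qed.

Lemma nneseries_recl1 (a : nat -> \bar R) : (forall n, 0 <= a n) ->
  \sum_(0 <= n <oo) a n = a 0%N + \sum_(0 <= n <oo) a n.+1.
Proof.
move=> a0; rewrite nneseries_recl//; congr (_ + _).
by rewrite -(nneseries_addn 1)//; apply: eq_eseriesr => n _; rewrite addn1.
Qed.

Lemma nneseries_exp (x : R) : (0 <= x)%R ->
  \sum_(0 <= n <oo) (x ^+ n / n`!%:R)%:E = (expR x)%:E.
Proof.
move=> x0; apply/cvg_lim => //; rewrite -[X in X --> _]/(fun n => _).
have -> : (fun n => \sum_(0 <= i < n) (x ^+ i / i`!%:R)%:E) = EFin \o series (exp_coeff x).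
  by apply/funext => n /=; rewrite sumEFin.
by apply/cvg_EFin; [exact: nearW|exact: is_cvg_series_exp_coeff].
Qed.

Definition poisson_coef (lambda : R) n : R := (lambda ^+ n / n`!%:R)%R.

Lemma poisson_coef_ge0 lambda n : (0 <= lambda)%R -> (0 <= poisson_coef lambda n)%R.
Proof. by move=> l0; rewrite /poisson_coef divr_ge0 ?exprn_ge0. Qed.

Lemma poisson_coefS lambda n :
  (poisson_coef lambda n.+1 * n.+1%:R = lambda * poisson_coef lambda n)%R.
Proof.
rewrite /poisson_coef factS natrM exprS; field.
by rewrite pnatr_eq0 -lt0n fact_gt0 addrC natr1 pnatr_eq0.
Qed.

(* The function part [exp(lambda f) - 1] of the convolution exponential. *)
Definition cexp (lambda : R) f : R -> \bar R := fun x =>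
  \sum_(0 <= n <oo) ((poisson_coef lambda n.+1)%:E * fconv_power f n.+1 x).

Lemma cp_densityE (lambda : R) (phi : R -> R) : causal (EFin \o phi) -> (0 <= lambda)%R ->
  cp_density lambda phi = fun x => ((expR lambda - 1)^-1)%:E * cexp lambda (EFin \o phi) x.
Proof.
move=> cphi l0; apply/funext => x; rewrite /cp_density; congr (_ * _).
(* [fconv_power] at index 0 is the density itself and not a zeroth power, so the padded sequence is
   0 there. *)
pose a n := if n is m.+1 then
  (poisson_coef lambda m.+1)%:E * fconv_power (EFin \o phi) m.+1 x else 0.
transitivity (\sum_(1 <= n <oo) a n).
  apply/congr_lim/funext => n; rewrite !big_nat; apply: eq_bigr => -[//|m] _ //.
rewrite -nneseries_addn; last first.
  move=> [//|n]; rewrite /a mule_ge0 ?lee_fin ?poisson_coef_ge0//.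
  exact: (causal_fconv_power _ n cphi).1.2.
by apply: eq_eseriesr => n _; rewrite addn1.
Qed.

Lemma causal_cexp_term lambda f n : (0 <= lambda)%R -> causal f ->
  causal (fun x => (poisson_coef lambda n.+1)%:E * fconv_power f n.+1 x).
Proof.
move=> l0 cf; apply: causalZ; first exact: poisson_coef_ge0.
exact: causal_fconv_power.
Qed.

Lemma causal_cexp lambda f : (0 <= lambda)%R -> causal f -> causal (cexp lambda f).
Proof.
move=> l0 cf; split.
  by apply: nneseries_nonneg_measurable => n; exact: (causal_cexp_term _ _ _ l0 cf).1.
move=> x x0; rewrite /cexp eseries0// => n _ _.
by rewrite (causal_cexp_term _ _ _ l0 cf).2.
Qed.

Lemma integral_cexp lambda f : (0 <= lambda)%R -> causal f -> \int[mu]_x f x = 1 ->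
  \int[mu]_x cexp lambda f x = (expR lambda - 1)%:E.
Proof.
move=> l0 cf f1; have ct n := causal_cexp_term lambda f n l0 cf.
rewrite /cexp integral_nneseries//; last 2 first.
- by move=> n; exact: (ct n).1.1.
- by move=> n x _; exact: (ct n).1.2.
transitivity (\sum_(0 <= n <oo) (poisson_coef lambda n.+1)%:E).
  apply: eq_eseriesr => n _; rewrite ge0_integralZl_EFin//.
  - by rewrite integral_fconv_power// mule1.
  - by move=> x _; exact: (causal_fconv_power _ n cf).1.2.
  - exact: (causal_fconv_power _ n cf).1.1.
  - exact: poisson_coef_ge0.
have := nneseries_exp lambda l0.
rewrite (nneseries_recl1 (fun n => (lambda ^+ n / n`!%:R)%:E)); last first.
  by move=> n; rewrite lee_fin; exact: poisson_coef_ge0.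
rewrite expr0 fact0 divr1 => /(congr1 (fun z => z - 1)).
by rewrite EFinB => <-; rewrite addeAC subee// add0e.
Qed.

Lemma le_cexp_term lambda f n x : (0 <= lambda)%R -> causal f ->
  (poisson_coef lambda n.+1)%:E * fconv_power f n.+1 x <= cexp lambda f x.
Proof.
move=> l0 cf; rewrite /cexp (@nneseriesD1 _ _ n)//; last first.
  by move=> k _; exact: (causal_cexp_term _ _ _ l0 cf).1.2.
rewrite leeDl//; apply: nneseries_ge0 => k _ _.
exact: (causal_cexp_term _ _ _ l0 cf).1.2.
Qed.

(* Multiplication by [x] is a derivation of the convolution algebra, so it maps
   [exp(lambda f)] to [lambda (x f)] convolved with [exp(lambda f)]. *)
Lemma mulid_cexp lambda f x : (0 <= lambda)%R -> causal f ->
  mulid (cexp lambda f) x =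
  lambda%:E * mulid f x + lambda%:E * fconv (mulid f) (cexp lambda f) x.
Proof.
move=> l0 cf; have cDf := causal_mulid _ cf.
have ct n := causal_cexp_term lambda f n l0 cf.
have cP k := causal_fconv_power f k cf.
rewrite /cexp fconv_nneseriesr; [|exact: cDf.1|by move=> n; exact: (ct n).1].
rewrite -nneseriesZl; last first.
  move=> n _; apply: (fconv_nonneg_measurable _ _ _ _).2; first exact: cDf.1.
  exact: (ct n).1.
rewrite {1}/mulid -nneseriesZl; last by move=> n _; exact: (ct n).1.2.
(* The first power is split off: the power rule would leave [mulid f] convolved with the delta at 0,
   which [cexp] leaves out. *)
rewrite nneseries_recl1; last by move=> n; exact: (causal_mulid _ (ct n)).1.2.
congr (_ + _).
  by rewrite /poisson_coef expr1 divr1 muleCA.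
apply: eq_eseriesr => n _.
rewrite muleCA -/(mulid _ x) mulid_fconv_power// fconvZr; last 3 first.
- exact: poisson_coef_ge0.
- exact: cDf.1.
- exact: (cP n).1.
by rewrite !muleA -!EFinM poisson_coefS.
Qed.
End half_line.

(** * Convolution powers of absolutely continuous measures *)

Section integral_density.
Context d (T : measurableType d) (R : realType) (mu m : {measure set T -> \bar R}).
Variables (phi : T -> R) (F : T -> \bar R).

Import HBNNSimple.

(** By [mE] both sides agree on indicators, by linearity on simple functions, and monotone
    convergence along [nnsfun_approx] carries this to [F]. *)
Lemma ge0_integral_density : measurable_fun setT (EFin \o phi) ->
  (forall x, 0 <= (EFin \o phi) x) ->
  (forall A, measurable A -> m A = \int[mu]_(x in A) (phi x)%:E) ->
  measurable_fun setT F -> (forall x, 0 <= F x) ->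
  \int[m]_x F x = \int[mu]_x (F x * (phi x)%:E).
Proof.
move=> mphi phi0 mE mF F0.
pose g := nnsfun_approx measurableT mF.
have gF x : (g n x)%:E @[n --> \oo] --> F x by exact: cvg_nnsfun_approx.
have g_ndecr x : {homo (fun n => g n x) : a b / (a <= b)%N >-> (a <= b)%R}.
  by move=> a b ab; exact/lefP/nd_nnsfun_approx.
have mg n : measurable_fun setT (EFin \o g n) by exact/measurable_EFinP.
transitivity (limn (fun n => \int[m]_x (g n x)%:E)).
  rewrite -monotone_convergence//.
  - by apply: eq_integral => x _; apply/esym/cvg_lim.
  - by move=> n x _; rewrite lee_fin.
  - by move=> x _ a b ab; rewrite lee_fin g_ndecr.
transitivity (limn (fun n => \int[mu]_x ((g n x)%:E * (phi x)%:E))); last first.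
  rewrite -monotone_convergence//.
  - by apply: eq_integral => x _; apply/cvg_lim => //; apply: cvgeZr.
  - by move=> n; apply: emeasurable_funM => //; exact: mg.
  - by move=> n x _; apply: mule_ge0 => //; [rewrite lee_fin|exact: phi0].
  - move=> x _ a b ab; apply: lee_wpmul2r; first exact: phi0.
    by rewrite lee_fin g_ndecr.
apply/congr_lim/funext => n.
transitivity (\sum_(k \in range (g n)) (k%:E * \int[mu]_(x in g n @^-1` [set k]) (phi x)%:E)).
  under eq_integral do rewrite fimfunE -fsumEFin//.
  rewrite ge0_integral_fsum//; last 2 first.
  - by move=> y; exact/measurable_EFinP/measurable_funM.
  - by move=> y x _; rewrite nnfun_muleindic_ge0.
  by apply: eq_fsbigr => r _; rewrite integralZl_indic_nnsfun// integral_indic//= setIT mE.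
transitivity (\sum_(k \in range (g n))
    \int[mu]_x ((k * \1_(g n @^-1` [set k]) x)%:E * (phi x)%:E)).
  apply: eq_fsbigr => r _; rewrite [in LHS]integral_mkcond epatch_indic.
  (* A negative [r] is no value of [g n], so its fibre is empty; only a nonnegative [r] can be
     pulled into the integral. *)
  have [r0|r0] := ltP r 0%R.
    rewrite preimage_nnfun0// integral0_eq ?mule0; last first.
      by move=> x _; rewrite indic0 mule0.
    by rewrite integral0_eq// => x _; rewrite indic0 mulr0 mul0e.
  rewrite -ge0_integralZl_EFin//.
  - by apply: eq_integral => x _; rewrite EFinM muleAC muleA.
  - by move=> x _; apply: mule_ge0 => //; [exact: phi0|rewrite lee_fin].
  - by apply: emeasurable_funM => //; exact/measurable_EFinP.
rewrite -ge0_integral_fsum//.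
- apply: eq_integral => x _; rewrite [in RHS]fimfunE -[in RHS]fsumEFin//.
  by rewrite ge0_mule_fsuml// => r; rewrite nnfun_muleindic_ge0.
- move=> r; apply: emeasurable_funM => //; exact/measurable_EFinP/measurable_funM.
- by move=> r x _; apply: mule_ge0; [rewrite nnfun_muleindic_ge0|exact: phi0].
Qed.

End integral_density.

Section compound_poisson_measure.
Context {R : realType}.
Local Notation mu := (@lebesgue_measure R).
Local Notation T := (measurableTypeR R).
Implicit Types f g h : R -> \bar R.

Section ac_measure_is_measure.
Variable f : R -> \bar R.
Hypothesis nf : nonneg_measurable f.

Let ac0 : ac_measure f set0 = 0. Proof. exact: integral_set0. Qed.

Let ac_ge0 A : 0 <= ac_measure f A.
Proof. by apply: integral_ge0 => x _; exact: nf.2. Qed.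

Let ac_sigma_additive : semi_sigma_additive (ac_measure f).
Proof.
move=> F mF tF mUF; rewrite /ac_measure ge0_integral_bigcup//; last first.
- by move=> x _; exact: nf.2.
- exact: measurable_funS nf.1.
by apply: is_cvg_ereal_nneg_natsum_cond => n _ _; exact: ac_ge0.
Qed.

Let ac_mixin := isMeasure.Build _ _ _ (ac_measure f) ac0 ac_ge0 ac_sigma_additive.
(** The statement uses the bare set function; this packed form coincides with it by conversion and
    makes integration theory applicable. *)
Definition ac_measure_pack : {measure set T -> \bar R} :=
  HB.pack (ac_measure f) ac_mixin.

End ac_measure_is_measure.

Lemma ge0_integral_ac_measure (phi : R -> R) (F : R -> \bar R) :
  nonneg_measurable (EFin \o phi) -> nonneg_measurable F ->
  \int[ac_measure (EFin \o phi)]_x F x = \int[mu]_x (F x * (phi x)%:E).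
Proof.
move=> nphi [mF F0]; have [mphi phi0] := nphi.
by apply: (@ge0_integral_density _ _ _ mu (ac_measure_pack _ nphi)).
Qed.

Lemma mconvE (m1 m2 : set T -> \bar R) A :
  mconv m1 m2 A = \int[m1]_x m2 [set y : T | A (x + y)%R].
Proof.
rewrite /mconv /pushforward /product_measure1; congr (integral _ _ _).
apply/funext => x /=; congr m2.
by apply/seteqP; split => y /=; rewrite /xsection /= inE.
Qed.

Lemma measurable_translate_preimage (A : set T) (x : R) : measurable A ->
  measurable [set y : T | A (x + y)%R].
Proof.
move=> mA; rewrite -[X in measurable X]setTI.
suff : measurable_fun setT (fun y : T => x + y : T)%R by apply.
exact: measurable_funD.
Qed.

(** Substitute [z = x + y] in the inner integral and exchange the integrals by Tonelli. Agreement of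
    [m] with the density measure is asked on measurable sets only, which is all that the induction
    on convolution powers provides. *)
Lemma mconv_ac (phi : R -> R) (g : R -> \bar R) (m : set T -> \bar R) A :
  nonneg_measurable (EFin \o phi) -> nonneg_measurable g ->
  (forall B, measurable B -> m B = ac_measure g B) -> measurable A ->
  mconv (ac_measure (EFin \o phi)) m A = ac_measure (fconv (EFin \o phi) g) A.
Proof.
move=> nphi ng mE mA; have [[mphi phi0] [mg g0]] := (nphi, ng).
(* The kernel after the substitution: the first coordinate is the summand distributed by [phi], the
   second is the sum. *)
pose k (z : T * T) := g (z.2 - z.1)%R * (\1_A z.2)%:E.
have mk : measurable_fun setT k.
  apply: emeasurable_funM.
    apply: (measurableT_comp mg) => /=.
    by apply: measurable_funB; [exact: measurable_snd|exact: measurable_fst].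
  apply/measurable_EFinP; apply: (measurableT_comp (measurable_indic mA)).
  exact: measurable_snd.
have k0 z : 0 <= k z by rewrite mule_ge0// lee_fin.
have E x : m [set y : T | A (x + y)%R] = \int[mu]_z k (x, z).
  have mS := measurable_translate_preimage A x mA.
  rewrite mE// /ac_measure integral_setE// -[RHS](integral_translate _ x).
    by apply: eq_integral => y _; rewrite /k/= addrK !indicE (addrC y).
  split => //; apply: (measurableT_comp mk); exact: measurable_pair1.
rewrite mconvE (_ : (fun x => m _) = fun x => \int[mu]_z k (x, z)); last exact/funext.
rewrite ge0_integral_ac_measure//; last first.
  split; last by move=> x; apply: integral_ge0.
  exact: (measurable_fun_fubini_tonelli_F (m2 := mu) k).
transitivity (\int[mu]_x \int[mu]_z (k (x, z) * (phi x)%:E)).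
  apply: eq_integral => x _; rewrite ge0_integralZr//.
  - by apply: (measurableT_comp mk); exact: measurable_pair1.
  - exact: phi0.
rewrite (fubini_tonelli (fun z : T * T => k z * (phi z.1)%:E)); last 2 first.
- apply: emeasurable_funM => //; apply: (measurableT_comp mphi); exact: measurable_fst.
- by move=> z; rewrite mule_ge0// phi0.
rewrite (fconvC _ _ nphi ng) /ac_measure integral_setE//.
apply: eq_integral => z _ /=.
rewrite /fconv -ge0_integralZr//.
- by apply: eq_integral => x _; rewrite /k/= muleAC.
- by apply: emeasurable_funM => //; exact: measurable_reflect.
- by move=> x _; rewrite mule_ge0// phi0.
Qed.

Lemma mconv_power_ac (phi : R -> R) n A : causal (EFin \o phi) -> measurable A ->
  mconv_power (ac_measure (EFin \o phi)) n.+1 A =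
  ac_measure (fconv_power (EFin \o phi) n.+1) A.
Proof.
move=> cphi; have nphi := cphi.1; elim: n A => [|n ih] A mA.
  rewrite /mconv_power /= mconvE ge0_integral_ac_measure//; last first.
    split=> //; rewrite (_ : (fun x => _) = fun x => (\1_A x)%:E).
      by apply/measurable_EFinP; exact: measurable_indic.
    by apply/funext => x; rewrite diracE indicE -[in RHS](addr0 x).
  rewrite /ac_measure [RHS]integral_setE//; apply: eq_integral => x _.
  by rewrite muleC diracE indicE -[in X in _ = _ * X](addr0 x).
by apply: mconv_ac => //; exact: (causal_fconv_power _ n cphi).1.
Qed.

Lemma compound_poissonE (lambda : R) (phi : R -> R) A : (0 < lambda)%R ->
  causal (EFin \o phi) -> measurable A ->
  compound_poisson lambda phi A =
  (expR (- lambda))%:E * \d_(0%R : T) A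
  + (1 - expR (- lambda))%:E * ac_measure (cp_density lambda phi) A.
Proof.
move=> l0 cphi mA; have l0' := ltW l0.
have ct n := causal_cexp_term lambda _ n l0' cphi.
have cP n := causal_fconv_power _ n cphi.
have cq := causal_cexp lambda _ l0' cphi.
rewrite /compound_poisson nneseries_recl1; last first.
  case=> [|n]; first by rewrite expr0 fact0 divr1 mul1e.
  rewrite mconv_power_ac// mule_ge0//; first by rewrite lee_fin; exact: poisson_coef_ge0.
  by apply: integral_ge0 => x _; exact: (cP n).1.2.
rewrite expr0 fact0 divr1 mul1e -[mconv_power _ 0 A]/(\d_(0%R : T) A).
rewrite (_ : \sum_(0 <= n <oo) _ = ac_measure (cexp lambda (EFin \o phi)) A); last first.
  rewrite /ac_measure /cexp integral_nneseries//; last 2 first.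
  - by move=> n; apply: measurable_funS (ct n).1.1.
  - by move=> n x _; exact: (ct n).1.2.
  apply: eq_eseriesr => n _; rewrite mconv_power_ac// ge0_integralZl_EFin//.
  - by move=> x _; exact: (cP n).1.2.
  - by apply: measurable_funS (cP n).1.1.
  - exact: poisson_coef_ge0.
rewrite ge0_muleDr//; last by apply: integral_ge0 => x _; exact: cq.1.2.
congr (_ + _); rewrite cp_densityE// /ac_measure ge0_integralZl_EFin//; last 3 first.
- by move=> x _; exact: cq.1.2.
- by apply: measurable_funS cq.1.1.
- by rewrite invr_ge0 subr_ge0 -expR0 ler_expR.
(* The constants match because [(1 - e^(-lambda)) / (e^lambda - 1) = e^(-lambda)]. *)
rewrite muleA -EFinM; congr (_%:E * _).
have e1 : (expR lambda - 1 != 0)%R by rewrite subr_eq0 -expR0 (inj_eq (@expR_inj R)) gt_eqF.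
rewrite expRN; field.
by rewrite e1 gt_eqF ?expR_gt0.
Qed.
End compound_poisson_measure.

(** * Uniform convergence for long-tailed functions *)

Section uniform_long_tail.
Context {R : realType}.
Local Notation mu := (@lebesgue_measure R).
Local Notation T := (measurableTypeR R).
Local Open Scope ring_scope.

(** Measurability is what upgrades the pointwise limits in [a] to limits uniform on bounded sets. *)
Definition long_tailed (r : R -> R) := [/\ measurable_fun setT r,
  \forall x \near +oo, 0 < r x & forall a, r (x + a) / r x @[x --> +oo] --> (1 : R)].

Lemma near_pinftyD (P : set R) (a : R) : (\forall x \near +oo, P x) ->
  \forall x \near +oo, P (x + a).
Proof.
move=> [M [Mr MP]]; exists (M - a); split; first exact: num_real.
by move=> x xM; apply: MP; rewrite -ltrBlDr.
Qed.

(** Truncation at 1 keeps the triangle inequality and supplies the bound for dominated convergence,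
    whatever the values of [ln (r x)] are. *)
Let d (s t : R) := Num.min 1 `|s - t|.

Let d_ge0 s t : 0 <= d s t. Proof. by rewrite le_min ler01 normr_ge0. Qed.

Let d_le1 s t : d s t <= 1. Proof. by rewrite ge_min lexx. Qed.

Let d_triangle s t u : d s t <= d u s + d u t.
Proof.
rewrite /d; have := ler_distD u s t; rewrite (distrC s u).
have := normr_ge0 (u - s); have := normr_ge0 (u - t).
by case: (lerP 1 `|s - t|); case: (lerP 1 `|u - s|); case: (lerP 1 `|u - t|) => *; lra.
Qed.

Let measurable_d (f g : T -> R) : measurable_fun setT f -> measurable_fun setT g ->
  measurable_fun setT (fun x => d (f x) (g x)).
Proof.
move=> mf mg; apply: measurable_minr => //.
by apply: measurableT_comp => //; exact: measurable_funB.
Qed.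

Variables (r : R -> R) (B : R).
Hypotheses (ltr : long_tailed r) (B0 : 0 < B).

Let D x y := d (ln (r (x + y))) (ln (r x)).

Let D_ge0 x y : 0 <= D x y. Proof. exact: d_ge0. Qed.

Let D_le1 x y : D x y <= 1. Proof. exact: d_le1. Qed.

Let D_cvg y : D x y @[x --> +oo] --> 0.
Proof.
have [mr r0 rr] := ltr.
have h : ln (r (x + y) / r x) @[x --> +oo] --> (0 : R).
  rewrite -(ln1 R); apply: (cvg_comp _ _ (rr y)).
  exact: continuous_ln.
have h2 : `|ln (r (x + y)) - ln (r x)| @[x --> +oo] --> (0 : R).
  rewrite -(normr0 R); apply: cvg_norm.
  apply: cvg_trans h; apply: near_eq_cvg.
  near=> x; rewrite ln_div// ?posrE; near: x => //.
  exact: (near_pinftyD (fun x => 0 < r x) y r0).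
apply: (@squeeze_cvgr _ _ _ _ (cst 0) _ _ _ _ _ h2); last exact: cvg_cst.
by near=> x; rewrite d_ge0/= ge_min lexx orbT.
Unshelve. all: end_near. Qed.

(** The window has length [2 B] so that, for [0 <= a <= B] and [y] between [B] and [2 B], it
    contains both [y] and [y - a]. *)
Let kk x y := (D x y * \1_`[0, B + B] y)%:E.

Let measurable_kk x : measurable_fun setT (kk x).
Proof.
have [mr _ _] := ltr.
apply/measurable_EFinP/measurable_funM; last exact: measurable_indic.
apply: measurable_d; last exact: measurable_cst.
apply: measurableT_comp; first exact: measurable_ln.
by apply: (measurableT_comp mr); exact: measurable_funD.
Qed.

Let kk_ge0 x y : (0 <= kk x y)%E.
Proof. by rewrite lee_fin mulr_ge0 ?D_ge0// indicE. Qed.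

Let K x := (\int[mu]_y kk x y)%E.

Let K_cvg (u : R^nat) : u n @[n --> \oo] --> +oo -> (K (u n) @[n --> \oo] --> 0)%E.
Proof.
move=> uy.
have cv : {ae mu, forall y, setT y -> (kk (u n) y @[n --> \oo] --> 0)%E}.
  apply: aeW => y _; rewrite /kk.
  apply/fine_cvgP; split; first exact: nearW.
  rewrite -[X in _ --> X](mul0r (\1_`[0, B + B] y)).
  apply: (@cvgM _ _ \oo _ (fun n => D (u n) y)); last exact: cvg_cst.
  by move/cvg_pinftyP: (D_cvg y); exact.
have ig := integrable_indic_itv 0 (B + B) true false.
have dom : {ae mu, forall y n, setT y -> (`|kk (u n) y| <= (\1_`[0, B + B] y)%:E)%E}.
  by apply: aeW => y n _; rewrite gee0_abs// lee_fin ler_piMl ?D_le1.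
have [_ _] := @dominated_convergence _ T R mu setT measurableT (fun n => kk (u n))
  (cst 0%E) _ (fun n => measurable_kk (u n)) (measurable_cst _) cv ig dom.
by rewrite integral0.
Qed.

(** Dominated convergence is about sequences: if the bound failed, some sequence tending to infinity
    would keep [K] above [e]. *)
Let K_near e : 0 < e -> \forall x \near +oo, (K x <= e%:E)%E.
Proof.
move=> e0; apply: contrapT => nK.
have ex n : exists x : R, n%:R < x /\ (e%:E < K x)%E.
  apply: contrapT => h; apply: nK; exists n%:R; split; first exact: num_real.
  by move=> x nx; rewrite leNgt; apply/negP => ?; apply: h; exists x.
have [u uP] := choice ex.
have uy : u n @[n --> \oo] --> +oo.
  apply/cvgryPge => A; near=> n; apply: ltW; apply: le_lt_trans (uP n).1.
  by near: n; exact: nbhs_infty_ger.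
have /fine_cvgP[_ /cvgrPdist_lt/(_ _ e0) h] := K_cvg u uy.
have /fine_cvgP[hf _] := K_cvg u uy.
have [n [hn fn]] : exists n, `|0 - fine (K (u n))| < e /\ K (u n) \is a fin_num.
  have [n _ hn] := filterI h hf.
  by exists n; exact: (hn n (leqnn n)).
have := (uP n).2; rewrite -(fineK fn) lte_fin; move: hn.
by rewrite sub0r normrN => /(le_lt_trans (ler_norm _)) => h1 /(lt_trans h1); rewrite ltxx.
Unshelve. all: end_near. Qed.

(* Average the triangle inequality for [d] through the points [x + y],
   [B <= y <= 2 B]. *)
Let D_le x a : 0 <= a <= B -> ((B * D x a)%:E <= K x + K (x + a))%E.
Proof.
move=> /andP[a0 aB]; have [mr _ _] := ltr.
have -> : K (x + a) = (\int[mu]_y kk (x + a) (y + - a))%E.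
  by rewrite (integral_translate (kk (x + a))).
rewrite -ge0_integralD//; last 2 first.
- exact: measurable_kk.
- by apply: (measurableT_comp (measurable_kk _)); exact: measurable_funD.
apply: (@le_trans _ _ (\int[mu]_y (D x a * \1_`[B, B + B] y)%:E)%E).
  under eq_integral do rewrite EFinM.
  rewrite ge0_integralZl_EFin//; last first.
    by apply/measurable_EFinP; exact: measurable_indic.
  rewrite integral_indic//= setIT lebesgue_measure_itv/= lte_fin ltrDl B0.
  by rewrite -EFinB addrK -EFinM mulrC.
apply: ge0_le_integral => //.
- by move=> y _; rewrite lee_fin mulr_ge0 ?D_ge0// indicE.
- by apply/measurable_EFinP/measurable_funM => //; exact: measurable_indic.
- by apply: emeasurable_funD; [exact: measurable_kk|apply: (measurableT_comp (measurable_kk _)); exact: measurable_funD].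
move=> y _; rewrite /kk -EFinD lee_fin !indicE.
have [yB|yB] := boolP (y \in `[B, B + B]%classic); last first.
  by rewrite mulr0 addr_ge0// mulr_ge0 ?D_ge0// indicE.
move: yB; rewrite inE/= in_itv/= => /andP[By yB].
rewrite !mem_set/= ?mulr1; [|by rewrite in_itv/=; lra..].
rewrite /D (_ : x + a + (y - a) = x + y); last by ring.
by rewrite [leRHS]addrC; exact: d_triangle.
Qed.

Lemma long_tailed_uniform e : 0 < e -> \forall x \near +oo,
  forall u, 0 <= u <= B -> `|r (x - u) / r x - 1| <= e.
Proof.
move=> e0; have [mr r0 rr] := ltr.
have [t0 t0_gt0 t0P] : exists2 t0 : R, 0 < t0 & forall t, `|t| < t0 -> `|expR t - 1| <= e.
  have /cvgrPdist_le/(_ _ e0)[t0 /= t00 h] := @continuous_expR R 0.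
  exists t0 => // t tt0; rewrite distrC -expR0; apply: h => /=.
  by rewrite sub0r normrN.
(* [de < 1] makes the truncation in [d] inactive and [de < t0] serves the exponential; two averages
   of at most [B * de / 2] each give [D <= de]. *)
pose de := Num.min t0 1 / 2.
have [de0 det0 de1] : [/\ 0 < de, de < t0 & de < 1].
  by rewrite /de; case: (ltrP t0 1) => ?; split; lra.
have BK : 0 < B * de / 2 by rewrite divr_gt0// mulr_gt0.
have H1 : \forall x \near +oo, 0 < r x /\ (K x <= (B * de / 2)%:E)%E.
  by apply: filterI => //; exact: K_near.
have [M [_ MP]] := near_pinftyD _ (- B) H1.
have [N [_ NP]] := H1.
exists (Num.max (M + B) N); split; first exact: num_real.
move=> x; rewrite gt_max => /andP[xM xN] u /andP[u0 uB].
have [rx Kx] := NP x xN.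
have [rxu Kxu] : 0 < r (x - u) /\ (K (x - u) <= (B * de / 2)%:E)%E.
  by have := MP (x - u + B); rewrite addrK; apply; lra.
have := D_le (x - u) u; rewrite u0 uB subrK => /(_ isT).
move=> /le_trans/(_ (leeD Kxu Kx)); rewrite -EFinD -splitr lee_fin ler_pM2l//.
rewrite /D /d subrK ge_min leNgt de1/= => h.
have -> : r (x - u) / r x = expR (ln (r (x - u)) - ln (r x)).
  by rewrite expRB !lnK.
by apply: t0P; apply: le_lt_trans det0; rewrite distrC.
Qed.
End uniform_long_tail.

(** * Asymptotics of convolutions *)

Section windows.
Context {R : realType}.
Local Notation mu := (@lebesgue_measure R).
Implicit Types f g h : R -> \bar R.

(* For causal [f], [g] and [2 A <= x], [f * g = head f g + head g f + mid f g]
   at [x]. *)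
Definition head f g (A x : R) := \int[mu]_(u in `[0%R, A[) (f (x - u)%R * g u).
Definition mid f g (A x : R) := \int[mu]_(u in `[A, (x - A)%R]) (f (x - u)%R * g u).

Let conv_measurable f g x : nonneg_measurable f -> nonneg_measurable g ->
  nonneg_measurable (fun u => f (x - u)%R * g u).
Proof.
by move=> nf ng; apply: nonneg_measurableM => //; exact: nonneg_measurable_reflect.
Qed.

Let indic_nonneg_measurable (A : set (measurableTypeR R)) : measurable A ->
  nonneg_measurable (fun x : R => (\1_A x)%:E).
Proof.
move=> mA; split; first exact/measurable_EFinP/measurable_indic.
by move=> x; rewrite lee_fin.
Qed.

Let headE f g A x : head f g A x = \int[mu]_u (f (x - u)%R * g u * (\1_`[0%R, A[ u)%:E).
Proof. exact: integral_setE. Qed.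

Let midE f g A x : mid f g A x = \int[mu]_u (f (x - u)%R * g u * (\1_`[A, (x - A)%R] u)%:E).
Proof. exact: integral_setE. Qed.

Lemma head_ge0 f g A x : nonneg_measurable f -> nonneg_measurable g -> 0 <= head f g A x.
Proof. by move=> [_ f0] [_ g0]; apply: integral_ge0 => u _; exact: mule_ge0. Qed.

Lemma mid_ge0 f g A x : nonneg_measurable f -> nonneg_measurable g -> 0 <= mid f g A x.
Proof. by move=> [_ f0] [_ g0]; apply: integral_ge0 => u _; exact: mule_ge0. Qed.

(** Reflection [u -> x - u] turns the range [u > x - A] into a head with [f] and [g] exchanged. The
    half-open heads and the closed middle range partition [[0, x]] exactly, and causality discards
    the rest. *)
Lemma fconv_split f g (A x : R) : causal f -> causal g -> (0 < A)%R -> (A + A <= x)%R ->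
  fconv f g x = head f g A x + head g f A x + mid f g A x.
Proof.
move=> [nf fN] [ng gN] A0 Ax.
have n1 := conv_measurable f g x nf ng; have n2 := conv_measurable g f x ng nf.
have i1 : nonneg_measurable (fun u : R => (\1_`[0%R, A[ u)%:E).
  exact: indic_nonneg_measurable.
have i2 : nonneg_measurable (fun u : R => (\1_`[A, (x - A)%R] u)%:E).
  exact: indic_nonneg_measurable.
have n11 := nonneg_measurableM _ _ n1 i1.
have n12 := nonneg_measurableM _ _ n1 i2.
have n21 := nonneg_measurable_reflect _ x (nonneg_measurableM _ _ n2 i1).
rewrite !headE midE.
rewrite -[X in _ + X + _](integral_reflect _ x); last exact: nonneg_measurableM.
rewrite -ge0_integralD//; first last.
- exact: n21.1.
- by move=> u _; exact: n21.2.
- exact: n11.1.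
- by move=> u _; exact: n11.2.
rewrite -ge0_integralD//; first last.
- exact: n12.1.
- by move=> u _; exact: n12.2.
- by apply: emeasurable_funD; [exact: n11.1|exact: n21.1].
- by move=> u _; apply: adde_ge0; [exact: n11.2|exact: n21.2].
apply: eq_integral => u _; rewrite subKr (muleC (g u)).
rewrite -ge0_muleDr ?lee_fin// -ge0_muleDr ?adde_ge0 ?lee_fin//.
have [u0|u0] := ltP u 0%R; first by rewrite gN// mule0 mul0e.
have [ux|ux] := ltP x u; first by rewrite fN ?subr_lt0// !mul0e.
rewrite -!EFinD !indicE -[LHS]mule1; congr (_ * _%:E); apply/esym.
rewrite !mem_setE !in_itv/= u0 subr_ge0 ux/= ltrBlDr -ltrBlDl.
case: (ltP u A) => uA; case: (ltP (x - A)%R u) => uxA /=; rewrite ?addr0 ?add0r//.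
by exfalso; lra.
Qed.

Lemma midC f g (A x : R) : nonneg_measurable f -> nonneg_measurable g ->
  mid f g A x = mid g f A x.
Proof.
move=> nf ng; rewrite !midE.
rewrite -[RHS](integral_reflect _ x); last first.
  by apply: nonneg_measurableM; [exact: conv_measurable|exact: indic_nonneg_measurable].
apply: eq_integral => u _; rewrite subKr (muleC (f _)); congr (_ * _%:E).
rewrite !indicE !mem_setE !in_itv/= lerD2l lerNl opprK andbC.
by rewrite lerBrDl -lerBrDr.
Qed.

(** The middle range is invariant under [u -> x - u], so the weight [x - u] averages to [x / 2]
    there. *)
Lemma mid_mulid f (A x : R) : causal f -> (0 < A)%R ->
  (2 : R)%:E * mid (mulid f) f A x = x%:E * mid f f A x.
Proof.
move=> cf A0; have cDf := causal_mulid _ cf.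
have [nf nDf] := (cf.1, cDf.1).
have [xA|Ax] := ltP (x - A)%R A.
  by rewrite /mid set_itv_ge ?bnd_simp -?ltNge// !integral_set0 !mule0.
have x0 : (0 <= x)%R by lra.
have n1 := conv_measurable f f x nf nf.
have n2 := conv_measurable _ f x nDf nf; have n3 := conv_measurable f _ x nf nDf.
transitivity (mid (mulid f) f A x + mid f (mulid f) A x).
  by rewrite [mid f _ _ _]midC// mule_natl mule2n.
rewrite /mid -ge0_integralD//; first last.
- by apply: measurable_funS n3.1.
- by move=> u _; exact: n3.2.
- by apply: measurable_funS n2.1.
- by move=> u _; exact: n2.2.
rewrite -ge0_integralZl_EFin//; last 2 first.
- by move=> u _; exact: n1.2.
- by apply: measurable_funS n1.1.
apply: eq_integral => u; rewrite inE/= in_itv/= => /andP[Au uA].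
rewrite /mulid [in RHS](_ : x%:E = (x - u)%:E + u%:E); last by rewrite -EFinD subrK.
rewrite ge0_muleDl ?lee_fin; [|lra..].
by congr (_ + _); [rewrite muleA|rewrite muleCA].
Qed.

Lemma le_mid f g1 g2 (A x k : R) : nonneg_measurable f ->
  nonneg_measurable g1 -> nonneg_measurable g2 -> (0 <= k)%R ->
  (forall u, (A <= u)%R -> g1 u <= k%:E * g2 u) ->
  mid f g1 A x <= k%:E * mid f g2 A x.
Proof.
move=> nf ng1 ng2 k0 g12.
have n1 := conv_measurable f g1 x nf ng1; have n2 := conv_measurable f g2 x nf ng2.
rewrite /mid -ge0_integralZl_EFin//; last 2 first.
- by move=> u _; exact: n2.2.
- by apply: measurable_funS n2.1.
apply: ge0_le_integral => //.
- by move=> u _; exact: n1.2.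
- by apply: measurable_funS n1.1.
- by apply: measurable_funeM; apply: measurable_funS n2.1.
- move=> u; rewrite /= in_itv/= => /andP[Au _].
  rewrite muleCA; apply: lee_wpmul2l; first exact: nf.2.
  exact: g12.
Qed.

Lemma ge_mid f g1 g2 (A x k : R) : nonneg_measurable f ->
  nonneg_measurable g1 -> nonneg_measurable g2 -> (0 <= k)%R ->
  (forall u, (A <= u)%R -> k%:E * g2 u <= g1 u) ->
  k%:E * mid f g2 A x <= mid f g1 A x.
Proof.
move=> nf ng1 ng2 k0 g12.
have n1 := conv_measurable f g1 x nf ng1; have n2 := conv_measurable f g2 x nf ng2.
rewrite /mid -ge0_integralZl_EFin//; last 2 first.
- by move=> u _; exact: n2.2.
- by apply: measurable_funS n2.1.
apply: ge0_le_integral => //.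
- by move=> u _; apply: mule_ge0 => //; exact: n2.2.
- by apply: measurable_funeM; apply: measurable_funS n2.1.
- by apply: measurable_funS n1.1.
- move=> u; rewrite /= in_itv/= => /andP[Au _].
  rewrite muleCA; apply: lee_wpmul2l; first exact: nf.2.
  exact: g12.
Qed.

Lemma cvg_integral_window g (G : R) : causal g -> \int[mu]_u g u = G%:E ->
  \int[mu]_(u in `[0%R, A[) g u @[A --> +oo%R] --> G%:E.
Proof.
move=> [[mg g0] gN] gE.
pose I A := \int[mu]_(u in `[0%R, A[) g u.
have I_nd A B : (A <= B)%R -> I A <= I B.
  move=> AB; apply: ge0_subset_integral => //; first exact: measurable_funS mg.
  by move=> u /=; rewrite !in_itv/= => /andP[-> /lt_le_trans]; exact.
have I_le A : I A <= \int[mu]_u g u.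
  by apply: ge0_subset_integral.
(* Integers suffice, since [I] is nondecreasing. *)
have cI : I n%:R @[n --> \oo] --> \int[mu]_u g u.
  rewrite (_ : \int[mu]_u g u = \int[mu]_(u in \bigcup_n `[0%R, n%:R[%classic) g u).
    apply: ge0_nondecreasing_set_cvg_integral => //.
    - move=> m n mn; rewrite subsetEset => u /=; rewrite !in_itv/= => /andP[-> /lt_le_trans]; apply.
      by rewrite ler_nat.
    - by move=> n; exact: measurable_funS mg.
  rewrite [RHS]integral_mkcond; apply: eq_integral => u _ /=; rewrite patchE.
  case: ifPn => //; rewrite notin_setE => h; apply: gN; rewrite ltNge; apply/negP => u0; apply: h.
  exists (Num.truncn u).+1 => //=; rewrite in_itv/= u0/=.
  by have /andP[] := truncn_itv u0.
have I0 A : 0 <= I A by apply: integral_ge0.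
have Ifin A : I A \is a fin_num.
  by rewrite ge0_fin_numE// (le_lt_trans (I_le A))// gE ltry.
apply/fine_cvgP; split; first exact: nearW.
move: cI; rewrite gE => /fine_cvgP[_ cI].
apply/cvgrPdist_le => e e0; have /cvgrPdist_le/(_ _ e0)[n _ /(_ n (leqnn n))/= hn] := cI.
near=> A; have nA : (n%:R <= A)%R by near: A; exact: nbhs_pinfty_ge.
have IAG : (fine (I A) <= G)%R by rewrite -lee_fin fineK// -gE.
rewrite ger0_norm ?subr_ge0//.
apply: le_trans hn; rewrite ger0_norm ?subr_ge0; last first.
  by rewrite -lee_fin fineK// -gE.
rewrite lerD2l lerN2; apply: fine_le; [exact: Ifin|exact: Ifin|exact: I_nd].
Unshelve. all: end_near. Qed.
End windows.

(** * Limits relative to a reference function *)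

Section asymptotic_calculus.
Context {R : realType}.
Local Notation mu := (@lebesgue_measure R).
Implicit Types (f g h : R -> \bar R) (r : R -> R).

(** Real bounds on both sides already force finiteness, so estimates in [\bar R] need no separate
    passage through [fine]. *)
Lemma cvg_EFin_bounds {T : Type} {F : set_system T} {FF : Filter F} (h : T -> \bar R) (c : R) :
  h x @[x --> F] --> c%:E <->
  forall e : R, (0 < e)%R -> \forall x \near F, (c - e)%:E <= h x <= (c + e)%:E.
Proof.
split=> [/fine_cvgP[hfin /cvgrPdist_le hc] e e0|hc].
  near=> x; have fx : h x \is a fin_num by near: x.
  rewrite -(fineK fx) !lee_fin.
  have : (`|c - fine (h x)| <= e)%R by near: x; exact: hc.
  by rewrite ler_distlC lerBlDr => /andP[-> ->].
apply/fine_cvgP; split.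
  have := hc 1%R ltr01; apply: filterS => x /andP[h1 h2].
  by rewrite fin_numElt (lt_le_trans _ h1) ?ltNyr// (le_lt_trans h2) ?ltry.
apply/cvgrPdist_le => e e0; have := hc e e0; apply: filterS => x /= /andP[h1 h2].
have fx : h x \is a fin_num.
  by rewrite fin_numElt (lt_le_trans _ h1) ?ltNyr// (le_lt_trans h2) ?ltry.
move: h1 h2; rewrite -(fineK fx) !lee_fin /= => h1 h2.
by rewrite ler_distlC h2 andbT lerBlDr -lerBlDr; lra.
Unshelve. all: end_near. Qed.

(* The filter of the iterated limit [x --> +oo] followed by [A --> +oo]. *)
Definition iter_pinfty : set_system (R * R) :=
  fun P => \forall A \near +oo%R, \forall x \near +oo%R, P (A, x).

Global Instance iter_pinfty_filter : ProperFilter iter_pinfty.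
Proof.
apply: Build_ProperFilter_ex.
  move=> P [M [_ MP]]; have [|N [_ NP]] := MP (M + 1)%R; first by rewrite ltrDl.
  by exists (M + 1, N + 1)%R; apply: NP; rewrite ltrDl.
split => [|P Q|P Q PQ]; rewrite /iter_pinfty/=.
- by apply: nearW => A; exact: nearW.
- by apply: filterS2 => A; exact: filterI.
- by apply: filterS => A; apply: filterS => x; exact: PQ.
Qed.

Lemma near_iter_snd (P : set R) : (\forall x \near +oo%R, P x) ->
  \forall z \near iter_pinfty, P z.2.
Proof. by move=> hP; exists 0%R; split. Qed.

Lemma near_iter_tail (P : set R) : (\forall x \near +oo%R, P x) ->
  \forall z \near iter_pinfty, forall u, (z.1 <= u)%R -> P u.
Proof.
move=> [M [_ MP]]; exists M; split; first exact: num_real.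
by move=> A MA; apply: (@nearW _ (pinfty_nbhs R)) => x u Au; apply: MP; exact: lt_le_trans Au.
Qed.

Lemma near_iter_window :
  \forall z \near iter_pinfty, (0 < z.1 /\ z.1 + z.1 <= z.2)%R.
Proof.
exists (0 : R)%R; split => // A A0; exists (A + A)%R; split; first exact: num_real.
by move=> x /ltW.
Qed.

Lemma cvg_iter_pinfty (h : R -> R -> \bar R) (c : R -> \bar R) (l : \bar R) :
  (forall A : R, (0 < A)%R -> h A x @[x --> +oo%R] --> c A) ->
  c A @[A --> +oo%R] --> l -> h z.1 z.2 @[z --> iter_pinfty] --> l.
Proof.
(* The inner limit needs [U] to be a neighbourhood of [c A] and not only to contain it, hence the
   interior. *)
move=> hc cl U Ul; have /cl := nbhs_interior Ul; rewrite /nbhs /= => cU.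
case: cU => M [_ MU]; exists (Num.max M 0)%R; split; first exact: num_real.
by move=> A; rewrite gt_max => /andP[MA A0]; apply: (hc A A0); exact: MU.
Qed.

(* [f] may be infinite near [0] and the reference [r] is only used near [+oo]. *)
Definition asymp r f (a : R) := f x * ((r x)^-1)%:E @[x --> +oo%R] --> a%:E.

Definition asymp2 r (F : R -> R -> \bar R) (a : R) :=
  F z.1 z.2 * ((r z.2)^-1)%:E @[z --> iter_pinfty] --> a%:E.

Definition eventually_pos r := \forall x \near +oo%R, (0 < r x)%R.

Lemma asympP r f a : eventually_pos r ->
  asymp r f a <-> (forall e : R, (0 < e)%R -> \forall x \near +oo%R,
    ((a - e) * r x)%:E <= f x <= ((a + e) * r x)%:E).
Proof.
move=> r0; rewrite /asymp cvg_EFin_bounds.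
have E x e : (0 < r x)%R ->
  ((a - e)%:E <= f x * ((r x)^-1)%:E <= (a + e)%:E) =
  (((a - e) * r x)%:E <= f x <= ((a + e) * r x)%:E).
  by move=> rx; rewrite !EFinM lee_pdivlMr// lee_pdivrMr//.
split=> h e e0; have {}h := h e e0.
  by near=> x; rewrite -E; [near: x|near: x].
by near=> x; rewrite E; [near: x|near: x].
Unshelve. all: end_near. Qed.

Lemma asymp2_asymp r f a : asymp2 r (fun _ x => f x) a <-> asymp r f a.
Proof.
split=> h U /h.
  rewrite /nbhs/= => -[M [_ MP]].
  by have := MP (M + 1)%R; apply; rewrite ltrDl.
by move=> hU; exists 0%R; split.
Qed.

Lemma asymp_uniform r f (a A e : R) : long_tailed r -> asymp r f a -> (0 <= a)%R ->
  (0 < A)%R -> (0 < e)%R -> \forall x \near +oo%R, forall u, (0 <= u < A)%R ->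
  ((a - e) * r x)%:E <= f (x - u)%R <= ((a + e) * r x)%:E.
Proof.
move=> lr /asympP af a0 A0 e0; have [mr r0 _] := lr.
(* In [(a + e1) * (1 + e2)] the three error terms [e1], [a * e2] and [e1 * e2] are each at most
   [e / 3]. *)
pose e1 := (e / 3)%R; pose e2 := Num.min 1%R (e / (3 * (a + 1)))%R.
have e10 : (0 < e1)%R by rewrite divr_gt0.
have a1 : (0 < 3 * (a + 1))%R by lra.
have e20 : (0 < e2)%R by rewrite lt_min ltr01 divr_gt0.
have e21 : (e2 <= 1)%R by rewrite ge_min lexx.
have e2a : (e2 * (3 * (a + 1)) <= e)%R.
  by rewrite -ler_pdivlMr// ge_min lexx orbT.
have [M [_ MP]] := af r0 e1 e10.
near=> x => u /andP[u0 uA].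
have rx : (0 < r x)%R by near: x.
have xM : (M < x - u)%R.
  rewrite ltrBrDr; apply: (@lt_le_trans _ _ (M + A)%R); first by rewrite ltrD2l.
  by near: x; apply: nbhs_pinfty_ge; exact: num_real.
have xu : (`|r (x - u) / r x - 1| <= e2)%R.
  have : (0 <= u <= A)%R by rewrite u0 ltW.
  by move: u {u0 uA xM}; near: x; exact: long_tailed_uniform.
have [q1 q2] : (r (x - u) <= (1 + e2) * r x /\ (1 - e2) * r x <= r (x - u))%R.
  by move: xu; rewrite ler_distl => /andP[]; rewrite ler_pdivlMr// ler_pdivrMr.
have [rx' e10' e20'] := And3 (ltW rx) (ltW e10) (ltW e20).
have /andP[f1 f2] := MP _ xM; apply/andP; split.
  apply: le_trans f1; rewrite lee_fin /e1.
  have p1 : (0 <= (r (x - u) - (1 - e2) * r x) * a)%R by rewrite mulr_ge0 ?subr_ge0//.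
  have p2 : (0 <= ((1 + e2) * r x - r (x - u)) * e1)%R by rewrite mulr_ge0 ?subr_ge0//.
  have p3 : (0 <= (1 - e2) * r x * e1)%R by apply: mulr_ge0 => //; rewrite mulr_ge0 ?subr_ge0//.
  have p4 : (0 <= (e - e2 * (3 * (a + 1))) * r x)%R by rewrite mulr_ge0 ?subr_ge0//.
  have p5 : (0 <= e2 * r x)%R by rewrite mulr_ge0//.
  by rewrite /e1 in p1 p2 p3 p4 *; nra.
apply: (le_trans f2); rewrite lee_fin /e1.
have p1 : (0 <= ((1 + e2) * r x - r (x - u)) * (a + e1))%R.
  by rewrite mulr_ge0 ?subr_ge0 ?addr_ge0//.
have p3 : (0 <= (1 - e2) * r x * e1)%R by apply: mulr_ge0 => //; rewrite mulr_ge0 ?subr_ge0//.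
have p4 : (0 <= (e - e2 * (3 * (a + 1))) * r x)%R by rewrite mulr_ge0 ?subr_ge0//.
have p5 : (0 <= e2 * r x)%R by rewrite mulr_ge0//.
by rewrite /e1 in p1 p3 p4 *; nra.
Unshelve. all: end_near. Qed.

(** For [u] in a bounded window, [f (x - u)] is uniformly close to [a * r x], which comes out of the
    integral. *)
Lemma cvg_head r f g (a A G : R) : long_tailed r -> asymp r f a -> (0 <= a)%R ->
  nonneg_measurable f -> nonneg_measurable g -> (0 < A)%R ->
  \int[mu]_(u in `[0%R, A[) g u = G%:E ->
  head f g A x * ((r x)^-1)%:E @[x --> +oo%R] --> (a * G)%:E.
Proof.
move=> lr af a0 nf ng A0 gG; have [mr r0 _] := lr.
have G0 : (0 <= G)%R.
  by rewrite -lee_fin -gG; apply: integral_ge0 => u _; exact: ng.2.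
apply/cvg_EFin_bounds => e e0.
have G1 : (0 < G + 1)%R by lra.
pose e' := (e / (G + 1))%R; have e'0 : (0 < e')%R by rewrite divr_gt0.
have e'G : (e' * G <= e)%R.
  have <- : (e' * (G + 1) = e)%R by rewrite divfK// gt_eqF.
  by rewrite ler_pM2l// lerDl.
near=> x; have rx : (0 < r x)%R by near: x.
have ineq : forall u, (0 <= u < A)%R ->
  ((a - e') * r x)%:E <= f (x - u)%R <= ((a + e') * r x)%:E.
  by near: x; exact: asymp_uniform.
have nfg : nonneg_measurable (fun u => f (x - u)%R * g u).
  by apply: nonneg_measurableM => //; exact: nonneg_measurable_reflect.
have intZ k : (0 <= k)%R -> \int[mu]_(u in `[0%R, A[) (k%:E * g u) = (k * G)%:E.
  move=> k0; rewrite ge0_integralZl_EFin ?gG//.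
    by move=> u _; exact: ng.2.
  exact: measurable_funS ng.1.
have up : head f g A x <= ((a + e') * r x * G)%:E.
  have k0 : (0 <= (a + e') * r x)%R by rewrite mulr_ge0 ?addr_ge0// ltW.
  rewrite -intZ//; apply: ge0_le_integral => //.
  - by move=> u _; exact: nfg.2.
  - exact: measurable_funS nfg.1.
  - by apply: measurable_funeM; exact: measurable_funS ng.1.
  - move=> u; rewrite /= in_itv/= => /ineq/andP[_ h].
    by apply: lee_wpmul2r => //; exact: ng.2.
have lo : ((a - e') * r x * G)%:E <= head f g A x.
  (* When [a < e'] the lower bound is nonpositive and holds because [head] is nonnegative; otherwise
     its factor can be pulled through the integral. *)
  have [ae|ae] := leP e' a; last first.
    apply: (@le_trans _ _ 0); last exact: head_ge0.
    rewrite lee_fin -mulrA; apply: mulr_le0_ge0.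
      by rewrite subr_le0 ltW.
    by apply: mulr_ge0 => //; exact: ltW.
  have k0 : (0 <= (a - e') * r x)%R by rewrite mulr_ge0 ?subr_ge0// ltW.
  rewrite -intZ//; apply: ge0_le_integral => //.
  - by move=> u _; rewrite mule_ge0//; exact: ng.2.
  - by apply: measurable_funeM; exact: measurable_funS ng.1.
  - exact: measurable_funS nfg.1.
  - move=> u; rewrite /= in_itv/= => /ineq/andP[h _].
    by apply: lee_wpmul2r => //; exact: ng.2.
rewrite lee_pdivlMr// lee_pdivrMr// -!EFinM.
apply/andP; split; [apply: le_trans lo|apply: le_trans up _].
  by rewrite lee_fin; nra.
by rewrite lee_fin; nra.
Unshelve. all: end_near. Qed.
End asymptotic_calculus.

(** * Heads and middle range under the iterated limit *)

Section asymptotics_of_convolutions.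
Context {R : realType}.
Local Notation mu := (@lebesgue_measure R).
Implicit Types (f g h : R -> \bar R) (r s : R -> R).

Lemma asymp_unique r f (a b : R) : asymp r f a -> asymp r f b -> a = b.
Proof.
move=> /(cvg_lim (@ereal_hausdorff R)) fa /(cvg_lim (@ereal_hausdorff R)).
by rewrite fa => -[].
Qed.

Lemma asymp_ref r f : eventually_pos r -> (\forall x \near +oo%R, f x = (r x)%:E) ->
  asymp r f 1.
Proof.
move=> r0 fr; have h : (fun=> 1%:E) x @[x --> +oo_R%R] --> (1%:E : \bar R) by exact: cvg_cst.
apply: cvg_trans h; apply: near_eq_cvg; near=> x; rewrite (near fr x)// -EFinM divff//.
by rewrite gt_eqF//; near: x.
Unshelve. all: end_near. Qed.

Lemma asympZ r f (k a : R) : asymp r f a -> asymp r (fun x => k%:E * f x) (k * a).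
Proof.
move=> fa; rewrite /asymp EFinM.
rewrite (_ : (fun x => _) = fun x => k%:E * (f x * ((r x)^-1)%:E)); last first.
  by apply/funext => x; rewrite muleA.
exact: cvgeZl.
Qed.

Lemma asymp_ge0 r f a : eventually_pos r -> (forall x, 0 <= f x) -> asymp r f a -> (0 <= a)%R.
Proof.
move=> r0 f0 fa; rewrite -lee_fin.
apply: (@lee_cvg_to _ _ _ _ (cst 0) _ _ _ (cvg_cst _) fa).
near=> x; rewrite mule_ge0// lee_fin invr_ge0 ltW//.
by near: x.
Unshelve. all: end_near. Qed.

Lemma asympD r f g (a b : R) : eventually_pos r -> (forall x, 0 <= f x) -> (forall x, 0 <= g x) ->
  asymp r f a -> asymp r g b -> asymp r (f \+ g) (a + b).
Proof.
move=> r0 f0 g0 fa gb; rewrite /asymp EFinD.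
by apply: cvg_trans (cvgeD _ fa gb) => //; apply: near_eq_cvg; near=> x; rewrite /= ge0_muleDl.
Unshelve. all: end_near. Qed.

Lemma asympB r f g (a c : R) : (forall x, 0 <= f x) -> (forall x, 0 <= g x) ->
  asymp r f a -> asymp r (f \+ g) c -> asymp r g (c - a).
Proof.
move=> f0 g0 fa fgc; rewrite /asymp EFinB.
apply: cvg_trans (cvgeB _ fgc fa) => //; apply: near_eq_cvg; near=> x.
have : f x * ((r x)^-1)%:E \is a fin_num.
  by near: x; have /fine_cvgP[] := fa.
by move=> ff; rewrite /= ge0_muleDl// addeAC subee// add0e.
Unshelve. all: end_near. Qed.

Lemma asymp0_le r f g (k : R) : eventually_pos r -> (forall x, 0 <= f x) ->
  (\forall x \near +oo%R, f x <= k%:E * g x) -> asymp r g 0 -> asymp r f 0.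
Proof.
move=> r0 f0 fg /(asympZ _ _ k); rewrite mulr0 => g0.
apply: (@squeeze_cvge _ _ _ _ (cst 0) _ (fun x => k%:E * g x * ((r x)^-1)%:E)) => //.
  near=> x; have rx : (0 <= (r x)^-1)%R by rewrite invr_ge0 ltW//; near: x.
  rewrite mule_ge0 ?lee_fin//= lee_wpmul2r ?lee_fin//.
  by near: x.
exact: cvg_cst.
Unshelve. all: end_near. Qed.

Lemma near_ratio_bounds r g1 g2 (b1 b2 e : R) : eventually_pos r ->
  asymp r g1 b1 -> asymp r g2 b2 -> (0 < b2)%R -> (0 < e)%R ->
  \forall x \near +oo%R, (b1 / b2 - e)%:E * g2 x <= g1 x <= (b1 / b2 + e)%:E * g2 x.
Proof.
move=> r0 /fine_cvgP[fin1 c1] /fine_cvgP[fin2 c2] b20 e0.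
have /cvgrPdist_le/(_ _ e0) c12 : (fine (g1 x * ((r x)^-1)%:E) / fine (g2 x * ((r x)^-1)%:E))%R
    @[x --> +oo%R] --> (b1 / b2)%R.
  by apply: cvgM => //; apply: cvgV => //; rewrite gt_eqF.
have p2 : \forall x \near +oo%R, (0 < fine (g2 x * ((r x)^-1)%:E))%R.
  by have := cvgr_gt _ c2 _ b20; exact.
near=> x.
have rx : (0 < r x)%R by near: x.
have rK g : g x = g x * ((r x)^-1)%:E * (r x)%:E.
  by rewrite -muleA -EFinM mulVf ?mule1// gt_eqF.
have f1 : g1 x * ((r x)^-1)%:E \is a fin_num by near: x.
have f2 : g2 x * ((r x)^-1)%:E \is a fin_num by near: x.
have k2 : (0 < fine (g2 x * ((r x)^-1)%:E))%R by near: x.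
have : (`|b1 / b2 - fine (g1 x * ((r x)^-1)%:E) / fine (g2 x * ((r x)^-1)%:E)| <= e)%R.
  by near: x.
have := rK g1; have := rK g2; rewrite -{1}(fineK f1) -{1}(fineK f2).
move: (fine (g1 x * _)) (fine (g2 x * _)) k2 => y1 y2 y20 -> ->.
rewrite ler_distlC => /andP[h1 h2].
rewrite !muleA -!EFinM !lee_fin !ler_pM2r//.
by rewrite -[X in _ && X]ler_pdivrMr// -[X in X && _]ler_pdivlMr// h1 h2.
Unshelve. all: end_near. Qed.

(** The middle range only sees [u >= A], where [g1 / g2] is close to [b1 / b2] once [A] is large.
    The scale [s] is separate from [r] so that a factor [mulid f], measured on the scale [idmul r],
    is covered. *)
Lemma mid_equiv r s f g1 g2 (b1 b2 m : R) : eventually_pos r -> eventually_pos s ->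
  nonneg_measurable f -> nonneg_measurable g1 -> nonneg_measurable g2 ->
  asymp r g1 b1 -> asymp r g2 b2 -> (0 < b2)%R ->
  asymp2 s (mid f g2) m -> asymp2 s (mid f g1) (b1 / b2 * m).
Proof.
move=> r0 s0 nf ng1 ng2 a1 a2 b20 hm.
have b10 : (0 <= b1)%R by exact: asymp_ge0 ng1.2 a1.
set b := (b1 / b2)%R; have b0 : (0 <= b)%R by rewrite divr_ge0// ltW.
have m0 : (0 <= m)%R.
  rewrite -lee_fin; apply: (@lee_cvg_to _ _ _ _ (cst 0) _ _ _ (cvg_cst _) hm).
  have := near_iter_snd _ s0; apply: filterS => z /= sz.
  by rewrite mule_ge0 ?mid_ge0// lee_fin invr_ge0 ltW.
apply/cvg_EFin_bounds => e e0.
have bm0 : (0 < b + m + 1)%R by lra.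
(* With [e1 <= 1], [(b + e1) * (m + e1)] exceeds [b * m] by at most [e1 * (b + m + 1)]. *)
pose e1 := Num.min 1%R (e / (b + m + 1))%R.
have e10 : (0 < e1)%R by rewrite lt_min ltr01 divr_gt0.
have e11 : (e1 <= 1)%R by rewrite ge_min lexx.
have e1e : (e1 * (b + m + 1) <= e)%R by rewrite -ler_pdivlMr// ge_min lexx orbT.
have Hg := near_iter_tail _ (near_ratio_bounds _ _ _ _ _ _ r0 a1 a2 b20 e10).
have Hs := near_iter_snd _ s0.
have /cvg_EFin_bounds/(_ _ e10) Hm := hm.
near=> z; have sz : (0 < s z.2)%R by near: z.
have /andP[] : (m - e1)%:E <= mid f g2 z.1 z.2 * ((s z.2)^-1)%:E <= (m + e1)%:E.
  by near: z.
have : forall u, (z.1 <= u)%R ->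
  (b - e1)%:E * g2 u <= g1 u <= (b + e1)%:E * g2 u by near: z.
move: (z.1) (z.2) sz => A x sx hu.
rewrite lee_pdivlMr// lee_pdivrMr// => l1 l2.
rewrite lee_pdivlMr// lee_pdivrMr//.
have up : mid f g1 A x <= (b + e1)%:E * mid f g2 A x.
  apply: le_mid => //; first by rewrite addr_ge0// ltW.
  by move=> u /hu/andP[].
apply/andP; split; last first.
  apply: le_trans up _; apply: (@le_trans _ _ ((b + e1)%:E * ((m + e1)%:E * (s x)%:E))).
    by rewrite lee_wpmul2l// lee_fin addr_ge0// ltW.
  rewrite -!EFinM lee_fin mulrA ler_pM2r//.
  have : (e1 * e1 <= e1)%R by rewrite ler_piMr// ltW.
  by nra.
have [be|be] := leP e1 b; last first.
  apply: (@le_trans _ _ 0); last exact: mid_ge0.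
  rewrite -EFinM lee_fin; apply: mulr_le0_ge0; last exact: ltW.
  have : (b * m <= e1 * m)%R by rewrite ler_wpM2r// ltW.
  by have := mulr_ge0 (ltW e10) b0; nra.
apply: (@le_trans _ _ ((b - e1)%:E * mid f g2 A x)); last first.
  apply: ge_mid => //; first by rewrite subr_ge0.
  by move=> u /hu/andP[].
apply: (@le_trans _ _ ((b - e1)%:E * ((m - e1)%:E * (s x)%:E))); last first.
  by rewrite lee_wpmul2l// lee_fin subr_ge0.
rewrite -!EFinM lee_fin mulrA ler_pM2r//.
have : (0 <= e1 * e1)%R by rewrite mulr_ge0// ltW.
by nra.
Unshelve. all: end_near. Qed.

Lemma mid0_le s f g1 g2 (k : R) : eventually_pos s ->
  nonneg_measurable f -> nonneg_measurable g1 -> nonneg_measurable g2 -> (0 <= k)%R ->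
  (\forall x \near +oo%R, g1 x <= k%:E * g2 x) ->
  asymp2 s (mid f g2) 0 -> asymp2 s (mid f g1) 0.
Proof.
move=> s0 nf ng1 ng2 k0 g12 h.
apply: (@squeeze_cvge _ _ _ _ (cst 0) _
    (fun z => k%:E * (mid f g2 z.1 z.2 * ((s z.2)^-1)%:E))).
- have Hs := near_iter_snd _ s0; have Hg := near_iter_tail _ g12.
  near=> z; have sz : (0 <= (s z.2)^-1)%R by rewrite invr_ge0 ltW//; near: z.
  rewrite mule_ge0 ?mid_ge0 ?lee_fin//= muleA lee_wpmul2r ?lee_fin//.
  by apply: le_mid => //; near: z.
- exact: cvg_cst.
- by rewrite -[X in _ --> X](mule0 k%:E); apply: cvgeZl.
Unshelve. all: end_near. Qed.

Lemma asymp2_midC s f g m : nonneg_measurable f -> nonneg_measurable g ->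
  asymp2 s (mid f g) m -> asymp2 s (mid g f) m.
Proof.
move=> nf ng; apply: cvg_trans; apply: near_eq_cvg; apply: nearW => z.
by rewrite midC.
Qed.

Lemma fin_integral_window g (G A : R) : nonneg_measurable g -> \int[mu]_u g u = G%:E ->
  \int[mu]_(u in `[0%R, A[) g u \is a fin_num.
Proof.
move=> [mg g0] gG; rewrite ge0_fin_numE; last exact: integral_ge0.
apply: (@le_lt_trans _ _ (\int[mu]_u g u)); last by rewrite gG ltry.
by apply: ge0_subset_integral.
Qed.

Lemma asymp2_head r f g (a G : R) : long_tailed r -> asymp r f a ->
  nonneg_measurable f -> causal g -> \int[mu]_u g u = G%:E ->
  asymp2 r (head f g) (a * G).
Proof.
move=> lr fa nf cg gG; have [_ r0 _] := lr.
have a0 : (0 <= a)%R by exact: asymp_ge0 nf.2 fa.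
apply: (@cvg_iter_pinfty _ (fun A x => head f g A x * ((r x)^-1)%:E) (fun A => a%:E * \int[mu]_(u in `[0%R, A[) g u)).
  move=> A A0; have fw := fin_integral_window g G A cg.1 gG.
  rewrite -(fineK fw) -EFinM; apply: cvg_head => //; first exact: cg.1.
  by rewrite fineK.
by rewrite EFinM; apply: cvgeZl => //; exact: cvg_integral_window.
Qed.

(** The inner limit is 0 for each fixed [A], so local integrability of [g] is enough. This matters
    for [g = mulid f], whose total integral, the mean, may be infinite. *)
Lemma asymp2_head0 r f g : long_tailed r -> asymp r f 0 ->
  nonneg_measurable f -> nonneg_measurable g ->
  (forall A : R, \int[mu]_(u in `[0%R, A[) g u \is a fin_num) -> asymp2 r (head f g) 0.
Proof.
move=> lr fa nf ng gA; apply: (@cvg_iter_pinfty _ (fun A x => head f g A x * ((r x)^-1)%:E) (cst 0)); last exact: cvg_cst.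
move=> A A0; rewrite /cst (_ : 0 = (0 * fine (\int[mu]_(u in `[0%R, A[) g u))%:E).
  by apply: cvg_head => //; rewrite fineK.
by rewrite mul0r.
Qed.

Lemma asymp_fconv r f g (a1 a2 m : R) : eventually_pos r -> causal f -> causal g ->
  asymp2 r (head f g) a1 -> asymp2 r (head g f) a2 -> asymp2 r (mid f g) m ->
  asymp r (fconv f g) (a1 + a2 + m).
Proof.
move=> r0 cf cg h1 h2 h3; apply/asymp2_asymp; rewrite /asymp2 !EFinD.
have Hr := near_iter_snd _ r0.
apply: cvg_trans (cvgeD _ (cvgeD _ h1 h2) h3) => //; apply: near_eq_cvg.
have HA := @near_iter_window R.
near=> z; have [A0 Ax] : (0 < z.1 /\ z.1 + z.1 <= z.2)%R by near: z.
rewrite /= (fconv_split f g z.1 z.2 cf cg A0 Ax).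
have [[nf _] [ng _]] := (cf, cg).
have [p1 p2] := (head_ge0 f g z.1 z.2 nf ng, head_ge0 g f z.1 z.2 ng nf).
have p3 := mid_ge0 f g z.1 z.2 nf ng; have p12 := adde_ge0 p1 p2.
by rewrite (ge0_muleDl _ p12 p3) (ge0_muleDl _ p1 p2).
Unshelve. all: end_near. Qed.

(** The splitting solved for the middle range: the two heads have finite limits and may be
    subtracted. *)
Lemma asymp2_mid r f g (a1 a2 t : R) : eventually_pos r -> causal f -> causal g ->
  asymp2 r (head f g) a1 -> asymp2 r (head g f) a2 -> asymp r (fconv f g) t ->
  asymp2 r (mid f g) (t - (a1 + a2)).
Proof.
move=> r0 cf cg h1 h2 /asymp2_asymp h3; rewrite /asymp2 EFinB EFinD.
have Hr := near_iter_snd _ r0.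
apply: cvg_trans (cvgeB _ h3 (cvgeD _ h1 h2)) => //; apply: near_eq_cvg.
have HA := @near_iter_window R.
have /fine_cvgP[F1 _] := h1; have /fine_cvgP[F2 _] := h2.
near=> z; have [A0 Ax] : (0 < z.1 /\ z.1 + z.1 <= z.2)%R by near: z.
have [[nf _] [ng _]] := (cf, cg).
rewrite /= (fconv_split f g z.1 z.2 cf cg A0 Ax).
have [p1 p2] := (head_ge0 f g z.1 z.2 nf ng, head_ge0 g f z.1 z.2 ng nf).
have p3 := mid_ge0 f g z.1 z.2 nf ng; have p12 := adde_ge0 p1 p2.
rewrite (ge0_muleDl _ p12 p3) (ge0_muleDl _ p1 p2) addeAC subee ?add0e// fin_numD; apply/andP; split; near: z => //.
Unshelve. all: end_near. Qed.

(* With [idmul r] as reference, [x f(x)] has the asymptotics of [f], and [f] itself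
   becomes negligible. *)
Definition idmul r : R -> R := fun x => (x * r x)%R.

Lemma eventually_pos_idmul r : eventually_pos r -> eventually_pos (idmul r).
Proof.
move=> r0; near=> x; apply: mulr_gt0; last by near: x.
by near: x; exact: nbhs_pinfty_gt.
Unshelve. all: end_near. Qed.

Lemma asymp_mulid r f a : asymp r f a <-> asymp (idmul r) (mulid f) a.
Proof.
have E : \forall x \near +oo%R, f x * ((r x)^-1)%:E = mulid f x * ((idmul r x)^-1)%:E.
  near=> x; rewrite /mulid /idmul invfM EFinM.
  have x0 : (x != 0)%R by rewrite gt_eqF//; near: x; exact: nbhs_pinfty_gt.
  by rewrite [RHS]muleACA -EFinM divff// mul1e.
split; apply: cvg_trans; apply: near_eq_cvg => //.
by apply: filterS E => x ->.
Unshelve. all: end_near. Qed.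

Lemma cvg_inv_pinfty : ((x : R)^-1)%R @[x --> +oo%R] --> (0 : R)%R.
Proof.
apply/cvgrPdist_le => e e0; near=> x.
have x0 : (0 < x)%R by near: x; exact: nbhs_pinfty_gt.
rewrite sub0r normrN gtr0_norm ?invr_gt0// -[leRHS]invrK lef_pV2 ?posrE ?invr_gt0//.
Unshelve. all: end_near. Qed.

Lemma asymp_idmul0 r f a : asymp r f a -> asymp (idmul r) f 0.
Proof.
move=> fa; rewrite /asymp -[X in _ --> X](mule0 a%:E).
have ix : ((x : R)^-1)%:E @[x --> +oo%R] --> 0.
  by apply/fine_cvgP; split; [exact: nearW|exact: cvg_inv_pinfty].
apply: cvg_trans (cvgeM _ fa ix) => //; apply: near_eq_cvg; near=> x.
by rewrite /= /idmul invfM mulrC EFinM muleA.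
Unshelve. all: end_near. Qed.

Lemma long_tailed_idmul r : long_tailed r -> long_tailed (idmul r).
Proof.
move=> [mr r0 rr]; split; first exact: measurable_funM.
  exact: eventually_pos_idmul.
move=> a; have h : ((1 + a / x) * (r (x + a) / r x))%R @[x --> +oo%R] --> (1 : R)%R.
  rewrite -[X in _ --> X]mulr1; apply: cvgM => //.
  rewrite -[X in _ --> X]addr0; apply: cvgD; first exact: cvg_cst.
  by rewrite -(mulr0 a); apply: cvgM; [exact: cvg_cst|exact: cvg_inv_pinfty].
apply: cvg_trans h; apply: near_eq_cvg; near=> x.
have x0 : (x != 0)%R by rewrite gt_eqF//; near: x; exact: nbhs_pinfty_gt.
have rx : (r x != 0)%R by rewrite gt_eqF//; near: x.
by rewrite /idmul; field; rewrite rx x0.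
Unshelve. all: end_near. Qed.

Lemma fin_integral_window_mulid f (F A : R) : causal f -> \int[mu]_u f u = F%:E ->
  \int[mu]_(u in `[0%R, A[) mulid f u \is a fin_num.
Proof.
move=> cf fF; have cDf := causal_mulid _ cf.
have [A0|A0] := leP A 0%R.
  by rewrite set_itv_ge ?bnd_simp -?leNgt// integral_set0.
have fw := fin_integral_window f F A cf.1 fF.
rewrite ge0_fin_numE; last by apply: integral_ge0 => u _; exact: cDf.1.2.
apply: (@le_lt_trans _ _ (\int[mu]_(u in `[0%R, A[) (A%:E * f u))).
  apply: ge0_le_integral => //.
  - by move=> u _; exact: cDf.1.2.
  - exact: measurable_funS cDf.1.1.
  - by apply: measurable_funeM; exact: measurable_funS cf.1.1.
  - move=> u; rewrite /= in_itv/= => /andP[_ uA]; rewrite /mulid lee_wpmul2r//.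
      exact: cf.1.2.
    by rewrite lee_fin ltW.
rewrite ge0_integralZl_EFin//; last 3 first.
- by move=> u _; exact: cf.1.2.
- exact: measurable_funS cf.1.1.
- exact: ltW.
by rewrite -(fineK fw) -EFinM ltry.
Qed.

Lemma asymp2_mid_mulid r f (J : R) : causal f ->
  asymp2 r (mid f f) J <-> asymp2 (idmul r) (mid (mulid f) f) (J / 2).
Proof.
move=> cf.
have E : \forall z \near iter_pinfty,
    (2^-1 : R)%:E * (mid f f z.1 z.2 * ((r z.2)^-1)%:E) =
    mid (mulid f) f z.1 z.2 * ((idmul r z.2)^-1)%:E.
  have HA := @near_iter_window R.
  near=> z; have [A0 Ax] : (0 < z.1 /\ z.1 + z.1 <= z.2)%R by near: z.
  have x0 : (z.2 != 0)%R by rewrite gt_eqF// (lt_le_trans _ Ax)// addr_gt0.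
  have -> : mid (mulid f) f z.1 z.2 = (2^-1 : R)%:E * (z.2%:E * mid f f z.1 z.2).
    by rewrite -mid_mulid// muleA -EFinM mulVf// mul1e.
  rewrite /idmul invfM EFinM -!muleA; congr (_ * _).
  rewrite [RHS]muleCA; congr (_ * _).
  by rewrite -!EFinM mulrA divff// mul1r.
split=> h.
  rewrite /asymp2 mulrC EFinM.
  apply: cvg_trans (cvgeZl (y := (2^-1 : R)%:E) _ h) => //.
  by apply: near_eq_cvg; apply: filterS E => z ->.
have E2 : \forall z \near iter_pinfty, (2 : R)%:E * (mid (mulid f) f z.1 z.2 * ((idmul r z.2)^-1)%:E) =
    mid f f z.1 z.2 * ((r z.2)^-1)%:E.
  by apply: filterS E => z <-; rewrite muleA -EFinM divff// mul1e.
rewrite /asymp2 (_ : J%:E = 2%:E * (J / 2)%:E); last first.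
  by rewrite -EFinM mulrC divfK.
apply: cvg_trans (cvgeZl (y := 2%:E) _ h) => //; exact: near_eq_cvg.
Unshelve. all: end_near. Qed.
End asymptotics_of_convolutions.

(** * The convolution exponential of a long-tailed density *)

Section comparison.
Context {R : realType}.
Local Notation mu := (@lebesgue_measure R).
Implicit Types (f g h q : R -> \bar R) (r : R -> R).

Variables (r : R -> R) (f : R -> \bar R).
Hypotheses (lr : long_tailed r) (cf : causal f) (f1 : \int[mu]_x f x = 1)
  (fr : asymp r f 1).

Let r0 : eventually_pos r. Proof. by case: lr. Qed.
Let s0 : eventually_pos (idmul r). Proof. exact: eventually_pos_idmul. Qed.
Let ls : long_tailed (idmul r). Proof. exact: long_tailed_idmul. Qed.
Let cDf : causal (mulid f). Proof. exact: causal_mulid. Qed.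
Let Df1 : asymp (idmul r) (mulid f) 1. Proof. exact: (asymp_mulid _ _ _).1 fr. Qed.

Let fin_Df (A : R) : \int[mu]_(u in `[0%R, A[) mulid f u \is a fin_num.
Proof. exact: fin_integral_window_mulid f1. Qed.

(** On the scale [x r(x)] the function [x f] keeps its constant 1, whereas [g], of order [r],
    becomes negligible; this is how the weight removes one of the two heads. *)
Let head_Df g (b G : R) : causal g -> \int[mu]_u g u = G%:E -> asymp r g b ->
  asymp2 (idmul r) (head (mulid f) g) G /\ asymp2 (idmul r) (head g (mulid f)) 0.
Proof.
move=> cg gG gb; split.
  by rewrite -(mul1r G); apply: asymp2_head => //; exact: cDf.1.
apply: asymp2_head0 => //; [exact: asymp_idmul0 gb|exact: cg.1|exact: cDf.1].
Qed.

(* Evaluating [f * f * f] directly, and through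
   [x (f * f * f) = 3 ((x f) * (f * f))], gives
   [3 + 3 J + J^2 = 3 + 3 J + 3/2 J^2]. *)
Lemma mid_limit_eq0 (J : R) : asymp2 r (mid f f) J -> J = 0%R.
Proof.
move=> hJ; pose f2 := fconv f f.
have cf2 : causal f2 by exact: causal_fconv.
have [nf nf2 nDf] := And3 cf.1 cf2.1 cDf.1.
have hf : asymp2 r (head f f) 1.
  by rewrite -(mulr1 1%R); apply: asymp2_head => //; exact: cf.1.
have hf2 : asymp r f2 (1 + 1 + J) by exact: asymp_fconv.
set c := (1 + 1 + J)%R in hf2.
have f2_1 : \int[mu]_x f2 x = 1.
  by rewrite integral_fconv ?f1 ?mule1//; exact: cf.1.
have hf3 : asymp r (fconv f f2) (1 + c + c * J).
  apply: asymp_fconv => //.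
  - by rewrite -(mulr1 1%R); apply: asymp2_head => //; exact: cf.1.
  - by rewrite -(mulr1 c); apply: asymp2_head => //; exact: cf2.1.
  - rewrite -{1}(divr1 c); exact: (@mid_equiv _ r r _ _ f).
have [hd1 hd2] := head_Df f2 c 1 cf2 f2_1 hf2.
have hDf3 : asymp (idmul r) (fconv (mulid f) f2) (1 + 0 + c * (J / 2)).
  apply: asymp_fconv => //.
  rewrite -{1}(divr1 c); apply: (@mid_equiv _ r (idmul r) _ _ f) => //.
  exact: (asymp2_mid_mulid _ _ _ cf).1.
have E : mulid (fconv f f2) = fun x => 3%:R%:E * fconv (mulid f) f2 x.
  exact: (mulid_fconv_power f 1 cf).
have := asympZ _ _ 3%:R _ hDf3; rewrite -E => /((asymp_mulid _ _ _).2) /(asymp_unique _ _ _ _ hf3).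
rewrite /c => e; have : (J * J = 0)%R by lra.
by move/eqP; rewrite mulf_eq0 orbb => /eqP.
Qed.

Variables (lambda : R).
Hypothesis l0 : (0 < lambda)%R.

Let q := cexp lambda f.
Let Q : R := (expR lambda - 1)%R.

Let l0' : (0 <= lambda)%R. Proof. exact: ltW. Qed.
Let cq : causal q. Proof. exact: causal_cexp. Qed.
Let qQ : \int[mu]_x q x = Q%:E. Proof. exact: integral_cexp. Qed.

Let steutel : mulid q = (fun x => lambda%:E * mulid f x) \+
  (fun x => lambda%:E * fconv (mulid f) q x).
Proof. by apply/funext => x; exact: mulid_cexp. Qed.

Let lDf_ge0 x : 0 <= lambda%:E * mulid f x.
Proof. by apply: mule_ge0; [rewrite lee_fin|exact: cDf.1.2]. Qed.

Let Dfq_nonneg : nonneg_measurable (fconv (mulid f) q).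
Proof. by apply: fconv_nonneg_measurable; [exact: cDf.1|exact: cq.1]. Qed.

Let lDfq_ge0 x : 0 <= lambda%:E * fconv (mulid f) q x.
Proof. by apply: mule_ge0; [rewrite lee_fin|exact: Dfq_nonneg.2]. Qed.

(** The identity for [x q] gives [(x f) * q] the constant [(C - lambda) / lambda]; minus the head
    [Q] this is the limit [m] of its middle range. Trading [q] for [C f] there yields [J = 2 m / C],
    and [J = 0] forces [(C - lambda) / lambda = Q]. *)
Lemma asymp_cexp_coef (C : R) : (0 < C)%R -> asymp r q C ->
  (C = lambda * expR lambda)%R /\ asymp2 r (mid f f) 0.
Proof.
move=> C0 qC.
have h1 := asympZ _ _ lambda _ Df1.
have : asymp (idmul r) (mulid q) C by exact: (asymp_mulid _ _ _).1 qC.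
rewrite steutel => /(asympB _ _ _ _ _ lDf_ge0 lDfq_ge0 h1)/(asympZ _ _ lambda^-1%R).
rewrite (_ : (fun x => _) = fconv (mulid f) q); last first.
  by apply/funext => x; rewrite muleA -EFinM mulVf ?mul1e// gt_eqF.
have [hd1 hd2] := head_Df q C Q cq qQ qC.
move=> /(asymp2_mid _ _ _ _ _ _ s0 cDf cq hd1 hd2).
set m := (_ - _)%R => hm.
have hm2 : asymp2 (idmul r) (mid (mulid f) f) (1 / C * m).
  apply: (@mid_equiv _ r (idmul r) _ _ q) => //; first exact: cDf.1.
  - exact: cf.1.
  - exact: cq.1.
have hJ : asymp2 r (mid f f) (1 / C * m * 2).
  by apply: (asymp2_mid_mulid _ _ _ cf).2; rewrite mulfK.
have J0 := mid_limit_eq0 _ hJ.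
split; last by rewrite J0 in hJ.
move/eqP: J0; rewrite !mulf_eq0 pnatr_eq0 oner_eq0 invr_eq0 (gt_eqF C0)/= orbF => /eqP.
rewrite /m /Q => e.
have {}e : (lambda^-1 * (C - lambda * 1) = expR lambda - 1)%R by lra.
have -> : (C = lambda * (lambda^-1 * (C - lambda * 1)) + lambda)%R.
  by rewrite mulrA divff ?mul1r ?gt_eqF//; lra.
by rewrite e; lra.
Qed.

(** The two factors of [mid f f] are replaced by [q] one after the other, with [midC] in between. *)
Lemma asymp_fconv_cexp (C : R) : (0 < C)%R -> asymp r q C -> asymp2 r (mid f f) 0 ->
  asymp r (fconv q q) (2 * Q * C).
Proof.
move=> C0 qC h0; have [nf nq] := (cf.1, cq.1).
have h1 : asymp2 r (mid f q) 0.
  by rewrite -(mulr0 (C / 1)%R); apply: (@mid_equiv _ r r _ _ f).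
have h2 : asymp2 r (mid q q) 0.
  by rewrite -(mulr0 (C / 1)%R); apply: (@mid_equiv _ r r _ _ f) => //; exact: asymp2_midC.
have hh : asymp2 r (head q q) (C * Q) by exact: asymp2_head.
by rewrite (_ : 2 * Q * C = C * Q + C * Q + 0)%R; [exact: asymp_fconv|lra].
Qed.

(** A crude bound [q = O(f)] is enough to start: it makes the middle range and the second head
    vanish on the scale [x r(x)], and the identity then yields the exact constant
    [lambda * (1 + Q)]. *)
Lemma asymp_cexp_of_bound (k : R) : asymp2 r (mid f f) 0 -> (0 <= k)%R ->
  (\forall x \near +oo%R, q x <= k%:E * f x) -> asymp r q (lambda * expR lambda).
Proof.
move=> h0 k0 qk; have [nf nq] := (cf.1, cq.1).
have h1 : asymp2 (idmul r) (mid (mulid f) q) 0.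
  apply: (@mid0_le _ _ _ _ f k) => //; first exact: cDf.1.
  have -> : 0%R = (0 / 2)%R :> R by rewrite mul0r.
  exact: (asymp2_mid_mulid _ _ _ cf).1.
have q0 : asymp (idmul r) q 0.
  apply: (@asymp0_le _ _ _ f k) => //; [exact: nq.2|exact: asymp_idmul0 fr].
have h2 : asymp2 (idmul r) (head (mulid f) q) (1 * Q).
  by apply: asymp2_head => //; exact: cDf.1.
have h3 : asymp2 (idmul r) (head q (mulid f)) 0.
  by apply: asymp2_head0 => //; exact: cDf.1.
have h4 := asymp_fconv _ _ _ _ _ _ s0 cDf cq h2 h3 h1.
apply: (asymp_mulid _ _ _).2; rewrite steutel.
rewrite (_ : lambda * expR lambda = lambda * 1 + lambda * (1 * Q + 0 + 0))%R.
  by apply: asympD => //; exact: asympZ.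
by rewrite /Q; lra.
Qed.

Lemma asymp_mid_subexp : asymp r (fconv f f) 2 -> asymp2 r (mid f f) 0.
Proof.
move=> ff.
have hf : asymp2 r (head f f) 1.
  by rewrite -(mulr1 1%R); apply: asymp2_head => //; exact: cf.1.
by have := asymp2_mid _ _ _ _ _ _ r0 cf cf hf hf ff; rewrite subrr.
Qed.
End comparison.

(** * Inversion of the convolution exponential *)

Section exponential_inversion.
Context {R : realType}.
Local Open Scope ring_scope.

Let e (x : R) n := x ^+ n / n`!%:R.

Lemma sum_triangle (F : nat -> nat -> R) N :
  \sum_(n < N) \sum_(m < N - n) F n m = \sum_(k < N) \sum_(n < k.+1) F n (k - n)%N.
Proof.
elim: N => [|N ih]; first by rewrite !big_ord0.
rewrite [RHS]big_ord_recr/= -ih.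
transitivity (\sum_(n < N.+1) (\sum_(m < N - n) F n m + F n (N - n)%N)).
  by apply: eq_bigr => n _; rewrite subSn ?big_ord_recr// -ltnS.
by rewrite big_split/= [X in X + _]big_ord_recr/= subnn big_ord0 addr0.
Qed.

Lemma exp_coef_binomial (x y : R) k :
  \sum_(n < k.+1) e x n * e y (k - n) = e (x + y) k.
Proof.
rewrite /e addrC exprDn big_distrl/=; apply: eq_bigr => n _.
have nk : (n <= k)%N by rewrite -ltnS.
have fact0 j : j`!%:R != 0 :> R by rewrite pnatr_eq0 -lt0n fact_gt0.
rewrite -mulr_natr -(bin_fact nk) !natrM.
have := fact0 n; have := fact0 (k - n)%N.
have : 'C(k, n)%:R != 0 :> R by rewrite pnatr_eq0 -lt0n bin_gt0.
by move=> *; field; apply/and3P.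
Qed.

(** This is the sum over [n < N] of [e l n] times the tail of the exponential series after [N - n]
    terms. In the present form its limit is visibly [e^l e^l - e^(2 l) = 0]. *)
Definition exp_remainder (l : R) N : R :=
  expR l * \sum_(n < N) e l n - \sum_(k < N) e (l + l) k.

Lemma cvg_exp_sum (x : R) : \sum_(n < N) e x n @[N --> \oo] --> expR x.
Proof.
rewrite (_ : (fun N => _) = series (exp_coeff x)); first exact: is_cvg_series_exp_coeff.
by apply/funext => N; rewrite /series/= big_mkord.
Qed.

Lemma cvg_exp_remainder (l : R) : exp_remainder l N @[N --> \oo] --> (0 : R).
Proof.
rewrite -(subrr (expR (l + l))) {1}expRD.
apply: cvgB; last exact: cvg_exp_sum.
by apply: cvgM; [exact: cvg_cst|exact: cvg_exp_sum].
Qed.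

(* [exp(- l)] applied to [exp(l)] applied to a bounded sequence, both truncated. *)
Lemma exp_inversion (l : R) (a b : nat -> R) N : 0 <= l -> (0 < N)%N ->
  (forall n K, `|b n - \sum_(m < K) e l m * a (n + m)%N| <= expR l - \sum_(m < K) e l m) ->
  `|a 0%N - \sum_(n < N) e (- l) n * b n| <= exp_remainder l N.
Proof.
move=> l0 N0 ab.
(* The inner series is cut at [N - n] so that the pairs fill the triangle [n + m < N] and regroup by
   [k = n + m]. The coefficient of [a k] is then [e (- l + l) k], which is 0 for [k > 0]. *)
have -> : a 0%N = \sum_(n < N) \sum_(m < N - n) e (- l) n * (e l m * a (n + m)%N).
  rewrite (sum_triangle (fun n m => e (- l) n * (e l m * a (n + m)%N))).
  transitivity (\sum_(k < N) e (- l + l) k * a k); last first.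
    apply: eq_bigr => k _; rewrite -exp_coef_binomial big_distrl/=.
    apply: eq_bigr => n _; rewrite mulrA subnKC// -ltnS; exact: ltn_ord.
  rewrite addNr; case: N N0 => // N _; rewrite big_ord_recl/= big1 => [|i _].
    by rewrite /e expr0 fact0 divr1 mul1r addr0.
  by rewrite /e/= expr0n/= mul0r mul0r.
rewrite -sumrB; apply: le_trans (ler_norm_sum _ _ _) _.
rewrite /exp_remainder.
have -> : \sum_(k < N) e (l + l) k = \sum_(n < N) e l n * \sum_(m < N - n) e l m.
  under [RHS]eq_bigr do rewrite big_distrr/=.
  rewrite (sum_triangle (fun n m => e l n * e l m)).
  by apply: eq_bigr => k _; rewrite exp_coef_binomial.
rewrite mulrC big_distrl/= -sumrB; apply: ler_sum => n _.
rewrite -big_distrr/= -mulrBr -mulrBr normrM distrC.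
have -> : `|e (- l) n| = e l n.
  by rewrite /e normrM normrX normrN normfV normr_nat ger0_norm.
apply: ler_wpM2l; last exact: ab.
by rewrite /e divr_ge0 ?exprn_ge0.
Qed.
End exponential_inversion.

(** * Convolutions with bounded functions *)

Section bounded_convolution.
Context {R : realType}.
Local Notation mu := (@lebesgue_measure R).
Implicit Types (f g h k : R -> \bar R).

Lemma fconv_head_bounds h g (M A x G GA : R) : nonneg_measurable h -> nonneg_measurable g ->
  (0 <= M)%R -> (forall y, h y <= M%:E) -> \int[mu]_u g u = G%:E ->
  \int[mu]_(u in `[0%R, A[) g u = GA%:E ->
  head h g A x <= fconv h g x <= head h g A x + (M * (G - GA))%:E.
Proof.
move=> nh ng M0 hM gG gA.
have nhg : nonneg_measurable (fun u => h (x - u)%R * g u).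
  by apply: nonneg_measurableM => //; exact: nonneg_measurable_reflect.
have mC : measurable (~` `[0%R, A[%classic : set (measurableTypeR R)).
  exact: measurableC.
have splitT k : nonneg_measurable k -> \int[mu]_u k u =
    \int[mu]_(u in `[0%R, A[) k u + \int[mu]_(u in ~` `[0%R, A[%classic) k u.
  move=> [mk k0]; rewrite -[in LHS](setUv `[0%R, A[%classic) ge0_integral_setU//.
  - exact: measurable_funS mk.
  - by rewrite disj_set2E setICr.
have gC : \int[mu]_(u in ~` `[0%R, A[%classic) g u = (G - GA)%:E.
  have := splitT g ng; rewrite gG gA => e.
  by rewrite EFinB e addeAC subee// add0e.
rewrite /fconv (splitT _ nhg) -/(head h g A x).
have p : 0 <= \int[mu]_(u in ~` `[0%R, A[%classic) (h (x - u)%R * g u).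
  by apply: integral_ge0 => u _; exact: nhg.2.
rewrite leeDl//= leeD2l// EFinM -gC -ge0_integralZl_EFin//; last 2 first.
- by move=> u _; exact: ng.2.
- exact: measurable_funS ng.1.
apply: ge0_le_integral => //.
- by move=> u _; exact: nhg.2.
- exact: measurable_funS nhg.1.
- by apply: measurable_funeM; exact: measurable_funS ng.1.
- by move=> u _; apply: lee_wpmul2r => //; exact: ng.2.
Qed.

(** Since [h <= M], the part of the convolution outside the window is at most [M] times the
    remaining mass of [g]. The summand [k] is carried along because in the application only the sum,
    and neither term alone, is known to converge. *)
Lemma cvg_add_fconv k h g (M G l : R) : nonneg_measurable h -> causal g ->
  (0 <= M)%R -> (forall y, h y <= M%:E) -> \int[mu]_u g u = G%:E ->
  (k z.2 + head h g z.1 z.2) @[z --> iter_pinfty] --> l%:E ->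
  (k x + fconv h g x) @[x --> +oo%R] --> l%:E.
Proof.
move=> nh cg M0 hM gG kl.
pose GA A := fine (\int[mu]_(u in `[0%R, A[) g u).
have GAE A : \int[mu]_(u in `[0%R, A[) g u = (GA A)%:E.
  by rewrite fineK//; exact: fin_integral_window cg.1 gG.
have rem0 : (M * (G - GA z.1))%:E @[z --> (@iter_pinfty R)] --> 0.
  apply: (@cvg_iter_pinfty _ (fun A x => (M * (G - GA A))%:E) (fun A => (M * (G - GA A))%:E)).
    by move=> A _; exact: cvg_cst.
  apply/fine_cvgP; split; first exact: nearW.
  rewrite -[X in _ --> X](mulr0 M) -[X in (M * X)%R](subrr G).
  apply: cvgM; first exact: cvg_cst.
  apply: cvgB; first exact: cvg_cst.
  exact: fine_cvg (cvg_integral_window _ _ cg gG).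
suff : (k z.2 + fconv h g z.2) @[z --> iter_pinfty] --> l%:E.
  move=> H U /H; rewrite /nbhs/= => -[N [_ NP]].
  by have := NP (N + 1)%R; apply; rewrite ltrDl.
apply: (@squeeze_cvge _ _ _ _ (fun z => k z.2 + head h g z.1 z.2) _
    (fun z => k z.2 + head h g z.1 z.2 + (M * (G - GA z.1))%:E)) => //.
  apply: nearW => z.
  have /andP[h1 h2] := fconv_head_bounds h g M z.1 z.2 G _ nh cg.1 M0 hM gG (GAE z.1).
  by rewrite leeD2l//= -addeA leeD2l.
by rewrite -[X in _ --> X]adde0; apply: cvgeD.
Qed.

Lemma long_tailed1 : long_tailed (fun _ : R => 1%R : R).
Proof.
split; first exact: measurable_cst.
  exact: nearW.
by move=> a; rewrite divr1; exact: cvg_cst.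
Qed.

Lemma cvg_fconv_bounded h g (M G l : R) : nonneg_measurable h -> causal g ->
  (0 <= M)%R -> (forall y, h y <= M%:E) -> \int[mu]_u g u = G%:E ->
  h x @[x --> +oo%R] --> l%:E -> fconv h g x @[x --> +oo%R] --> (l * G)%:E.
Proof.
move=> nh cg M0 hM gG hl.
have a1 : asymp (fun=> 1%R) h l.
  apply: cvg_trans hl; apply: near_eq_cvg; apply: nearW => x.
  by rewrite invr1 mule1.
have := asymp2_head _ _ _ _ _ long_tailed1 a1 nh cg gG.
move=> H; have := @cvg_add_fconv (cst 0) h g M G (l * G)%R nh cg M0 hM gG.
have H' : (cst 0 z.2 + head h g z.1 z.2) @[z --> iter_pinfty] --> (l * G)%:E.
  apply: cvg_trans H; apply: near_eq_cvg; apply: nearW => z.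
  by rewrite /cst add0e invr1 mule1.
move=> /(_ H'); apply: cvg_trans; apply: near_eq_cvg; apply: nearW => x.
by rewrite /cst add0e.
Qed.

Variables (f rho : R -> \bar R) (l : R).
Hypotheses (cf : causal f) (f1 : \int[mu]_x f x = 1) (l0 : (0 < l)%R)
  (nrho : nonneg_measurable rho) (rho1 : forall x, rho x <= 1).

Let a n := iter n (fconv f) rho.

Let na n : nonneg_measurable (a n).
Proof. by elim: n => [//|n ih]; apply: fconv_nonneg_measurable => //; exact: cf.1. Qed.

Let a_le1 n x : a n x <= 1.
Proof.
elim: n x => [//|n ih] x; rewrite /a iterS fconvC; [|exact: cf.1|exact: na].
apply: (@le_trans _ _ (\int[mu]_u f u)); last by rewrite f1.
apply: ge0_le_integral => //.
- by move=> u _; apply: mule_ge0; [exact: (na n).2|exact: cf.1.2].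
- apply: emeasurable_funM; last exact: cf.1.1.
  exact: (nonneg_measurable_reflect _ x (na n)).1.
- exact: cf.1.1.
- move=> u _; rewrite -[leRHS]mul1e; apply: lee_wpmul2r; last exact: ih.
  exact: cf.1.2.
Qed.

Let a_fin n x : a n x \is a fin_num.
Proof.
by rewrite ge0_fin_numE; [exact: le_lt_trans (a_le1 n x) (ltry _)|exact: (na n).2].
Qed.

Let l0' : (0 <= l)%R. Proof. exact: ltW. Qed.

Let c_ge0 n : 0 <= (poisson_coef l n)%:E.
Proof. by rewrite lee_fin poisson_coef_ge0. Qed.

(** [b n] is [exp(l f)] applied to [f^n * rho]. Once [b 0] tends to 1 so do all the others, as
    convolution with a probability density preserves limits of bounded functions. *)
Let b (n : nat) x := \sum_(0 <= k <oo) ((poisson_coef l k)%:E * a (n + k)%N x).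

Let nca (n k : nat) : nonneg_measurable (fun x => (poisson_coef l k)%:E * a (n + k)%N x).
Proof.
split; first by apply: measurable_funeM; exact: (na _).1.
by move=> x; apply: mule_ge0 => //; exact: (na _).2.
Qed.

Let nb n : nonneg_measurable (b n).
Proof. exact: nneseries_nonneg_measurable. Qed.

Let bS n : b n.+1 = fconv f (b n).
Proof.
rewrite /b fconv_nneseriesr//; last exact: cf.1.
apply/funext => x; apply: eq_eseriesr => k _.
rewrite fconvZr//; [exact: poisson_coef_ge0|exact: cf.1].
Qed.

Let b_le n x : b n x <= (expR l)%:E.
Proof.
rewrite -(nneseries_exp l)//; apply: lee_nneseries.
  by move=> k _ _; exact: (nca n k).2.
move=> k _; rewrite -[leRHS]mule1; apply: lee_wpmul2l => //.
Qed.

Let fconv_rho_power n : fconv rho (fconv_power f n.+1) = a n.+1.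
Proof.
elim: n => [|n ih]; first by rewrite /= fconvC//; exact: cf.1.
rewrite fconv_powerS /a iterS -/(a n.+1) -ih.
have [nf nP] := (cf.1, (causal_fconv_power f n cf).1).
by rewrite (fconvA _ _ _ nrho nf nP) (fconvC _ _ nrho nf) (fconvA _ _ _ nf nrho nP).
Qed.

Let b0E x : b 0 x = rho x + fconv rho (cexp l f) x.
Proof.
rewrite /b nneseries_recl1; last by move=> k; exact: (nca 0 k).2.
rewrite {1}/poisson_coef expr0 fact0 divr1 mul1e; congr (_ + _).
have ct n := causal_cexp_term l f n l0' cf.
rewrite /cexp fconv_nneseriesr//; last by move=> n; exact: (ct n).1.
apply: eq_eseriesr => k _; rewrite fconvZr//; last 2 first.
- exact: poisson_coef_ge0.
- exact: (causal_fconv_power f k cf).1.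
by rewrite fconv_rho_power.
Qed.

Let b_cvg n : (rho x + fconv rho (cexp l f) x) @[x --> +oo%R] --> 1%:E ->
  b n x @[x --> +oo%R] --> 1%:E.
Proof.
move=> H; elim: n => [|n ih].
  by apply: cvg_trans H; apply: near_eq_cvg; apply: nearW => x; rewrite b0E.
rewrite bS fconvC//; last exact: cf.1.
rewrite -(mulr1 1%R); apply: (cvg_fconv_bounded _ _ (expR l)) => //.
Qed.

(** As every [a n] is at most 1, the truncation error is a tail of the exponential series, uniformly
    in [n] and [x]. *)
Let b_trunc x n K : (`|fine (b n x) - \sum_(m < K) l ^+ m / m`!%:R * fine (a (n + m)%N x)|
  <= expR l - \sum_(m < K) l ^+ m / m`!%:R)%R.
Proof.
have bfin : b n x \is a fin_num.
  rewrite ge0_fin_numE; last exact: (nb n).2.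
  exact: le_lt_trans (b_le n x) (ltry _).
have e1 : b n x = (\sum_(m < K) l ^+ m / m`!%:R * fine (a (n + m)%N x))%:E +
    \sum_(K <= k <oo) ((poisson_coef l k)%:E * a (n + k)%N x).
  rewrite /b (@nneseries_split _ _ 0 K); last by move=> k _; exact: (nca n k).2.
  rewrite add0n big_mkord -sumEFin; congr (_ + _).
  by apply: eq_bigr => m _; rewrite -[in LHS](fineK (a_fin (n + m)%N x)) -EFinM.
have e2 : (expR l)%:E = (\sum_(m < K) l ^+ m / m`!%:R)%:E +
    \sum_(K <= k <oo) (poisson_coef l k)%:E.
  rewrite -(nneseries_exp l)// (@nneseries_split _ _ 0 K); last first.
    by move=> k _; exact: c_ge0.
  by rewrite add0n big_mkord -sumEFin.
have t0 : 0 <= \sum_(K <= k <oo) ((poisson_coef l k)%:E * a (n + k)%N x).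
  by apply: nneseries_ge0 => k _ _; exact: (nca n k).2.
have t1 : \sum_(K <= k <oo) ((poisson_coef l k)%:E * a (n + k)%N x) <=
    \sum_(K <= k <oo) (poisson_coef l k)%:E.
  apply: lee_nneseries; first by move=> k _ _; exact: (nca n k).2.
  by move=> k _; rewrite -[leRHS]mule1; apply: lee_wpmul2l.
have e3 : (fine (b n x) - \sum_(m < K) l ^+ m / m`!%:R * fine (a (n + m)%N x))%:E =
    \sum_(K <= k <oo) ((poisson_coef l k)%:E * a (n + k)%N x).
  by rewrite EFinB fineK// e1 addeAC subee// add0e.
rewrite ger0_norm; last by rewrite -lee_fin e3.
by rewrite -lee_fin e3 EFinB e2 addeAC subee// add0e.
Qed.

(** Uniformly in [x], [rho] is within [exp_remainder l N] of a finite signed sum of the [b n].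
    Fixing [N] first leaves finitely many limits [b n --> 1] and no signed series in [\bar R]. *)
Lemma exp_deconvolution : (rho x + fconv rho (cexp l f) x) @[x --> +oo%R] --> 1%:E ->
  rho x @[x --> +oo%R] --> (expR (- l))%:E.
Proof.
move=> H; apply/fine_cvgP; split; first by apply: nearW => x; exact: (a_fin 0).
apply/cvgrPdist_le => e e0.
have e3 : (0 < e / 3)%R by rewrite divr_gt0.
have /cvgrPdist_le/(_ _ e3) R1 := cvg_exp_remainder l.
have /cvgrPdist_le/(_ _ e3) R2 := cvg_exp_sum (- l)%R.
have [N [N0 r1 r2]] : exists N, [/\ (0 < N)%N, (`|0 - exp_remainder l N| <= e / 3)%R &
    (`|expR (- l) - \sum_(n < N) (- l) ^+ n / n`!%:R| <= e / 3)%R].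
  have [N _ NP] := filterI (nbhs_infty_gt 0) (filterI R1 R2).
  by have [? []] := NP N (leqnn N); exists N.
have fin_cvg : (\sum_(n < N) (- l) ^+ n / n`!%:R * fine (b n x))%R @[x --> +oo%R] -->
    (\sum_(n < N) (- l) ^+ n / n`!%:R)%R.
  have -> : (\sum_(n < N) (- l) ^+ n / n`!%:R = \sum_(n < N) (- l) ^+ n / n`!%:R * 1 :> R)%R.
    by apply: eq_bigr => n _; rewrite mulr1.
  apply: cvg_big => [|n _]; first exact: add_continuous.
  apply: cvgM; first exact: cvg_cst.
  exact: fine_cvg (b_cvg n H).
have /cvgrPdist_le/(_ _ e3) R3 := fin_cvg.
near=> x.
have r3 : (`|\sum_(n < N) (- l) ^+ n / n`!%:R -
  \sum_(n < N) (- l) ^+ n / n`!%:R * fine (b n x)| <= e / 3)%R by near: x.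
have := exp_inversion l (fun n => fine (a n x)) (fun n => fine (b n x)) N l0' N0 (b_trunc x).
rewrite -/(a 0 x); move: r1 r2 r3; rewrite sub0r normrN.
move: (exp_remainder _ _) (\sum_(n < N) _)%R (\sum_(n < N) _)%R => t1 t2 t3.
rewrite /a/= => /(le_trans (ler_norm _)) r1; rewrite !ler_distlC.
move=> /andP[? ?] /andP[? ?] /andP[? ?]; apply/andP; split; lra.
Unshelve. all: end_near. Qed.
End bounded_convolution.

(** * From a subexponential exponential back to its density *)

Section deconvolution.
Context {R : realType}.
Local Notation mu := (@lebesgue_measure R).

Variables (f : R -> \bar R) (l : R).
Hypotheses (cf : causal f) (f1 : \int[mu]_x f x = 1) (l0 : (0 < l)%R).

Let q := cexp l f.
Let Q : R := (expR l - 1)%R.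
(** The reference is [q], because a long tail of [f] is still to be proved; control on [f] at
    infinity comes from [l f <= q] and the identity for [x q]. *)
Let r : R -> R := fun x => fine (q x).
Let s := idmul r.

Hypotheses (lr : long_tailed r) (qfin : \forall x \near +oo%R, q x = (r x)%:E)
  (qq : asymp r (fconv q q) (2 * Q)).

Let l0' : (0 <= l)%R. Proof. exact: ltW. Qed.
Let cq : causal q. Proof. exact: causal_cexp. Qed.
Let qQ : \int[mu]_x q x = Q%:E. Proof. exact: integral_cexp. Qed.
Let r0 : eventually_pos r. Proof. by case: lr. Qed.
Let s0 : eventually_pos s. Proof. exact: eventually_pos_idmul. Qed.
Let ls : long_tailed s. Proof. exact: long_tailed_idmul. Qed.
Let qr : asymp r q 1. Proof. exact: asymp_ref. Qed.
Let cDf : causal (mulid f). Proof. exact: causal_mulid. Qed.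

Let r_ge0 x : (0 <= r x)%R. Proof. by rewrite fine_ge0//; exact: cq.1.2. Qed.

Let lf_le_q x : l%:E * f x <= q x.
Proof.
have := le_cexp_term l f 0 x l0' cf.
by rewrite /poisson_coef expr1 divr1.
Qed.

(* By [x / 0 = 0] and [fine +oo = 0], [rho] vanishes where [q] is [0] or [+oo],
   so that [rho <= 1] everywhere. *)
Let rho_r (x : R) : R := (l * fine (f x) / r x)%R.
Let rho (x : R) : \bar R := (rho_r x)%:E.

Let rho_nonneg : nonneg_measurable rho.
Proof.
split; last first.
  move=> x; rewrite lee_fin divr_ge0// mulr_ge0// fine_ge0//.
  exact: cf.1.2.
apply/measurable_EFinP; apply: measurable_funM.
  apply: measurable_funM; first exact: measurable_cst.
  by apply: (@measurableT_comp _ _ _ _ _ _ fine _ f); [exact: fine_measurable|exact: cf.1.1].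
rewrite (_ : (fun x => _) = (fun x => r x `^ (-1))%R); last first.
  by apply/funext => x; rewrite powR_inv1.
by apply: (@measurableT_comp _ _ _ _ _ _ (fun y : R => y `^ (-1))%R _ r);
  [exact: measurable_powR|case: lr].
Qed.

Let rho_le1 x : rho x <= 1.
Proof.
rewrite lee_fin /rho_r; have [rx|rx] := eqVneq (r x) 0%R.
  by rewrite rx invr0 mulr0.
have rx0 : (0 < r x)%R by rewrite lt_neqAle eq_sym rx r_ge0.
rewrite ler_pdivrMr// mul1r -lee_fin.
have fq : q x \is a fin_num.
  by move: rx; rewrite /r; case: (q x) => //=; rewrite eqxx.
have ff : f x \is a fin_num.
  rewrite ge0_fin_numE; last exact: cf.1.2.
  rewrite ltNge leye_eq; apply/negP => /eqP fx.
  have := lf_le_q x; rewrite fx gt0_muley ?lte_fin// leye_eq => /eqP qx.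
  by rewrite qx in fq.
by rewrite EFinM !fineK.
Qed.

Let ffin : \forall x \near +oo%R, f x \is a fin_num.
Proof.
near=> x; rewrite ge0_fin_numE; last exact: cf.1.2.
have qx : q x = (r x)%:E by near: x.
rewrite ltNge leye_eq; apply/negP => /eqP fx.
by have := lf_le_q x; rewrite fx gt0_muley ?lte_fin// qx leye_eq.
Unshelve. all: end_near. Qed.

Let rhoE : \forall x \near +oo%R, rho x = l%:E * mulid f x * ((s x)^-1)%:E.
Proof.
near=> x; have fx : f x \is a fin_num by near: x.
have x0 : (x != 0)%R by rewrite gt_eqF//; near: x; exact: nbhs_pinfty_gt.
have rx : (r x != 0)%R by rewrite gt_eqF//; near: x.
rewrite /rho /mulid -(fineK fx) -!EFinM; congr EFin.
by rewrite /rho_r /s /idmul; field; rewrite rx x0.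
Unshelve. all: end_near. Qed.

Let mid_qq : asymp2 r (mid q q) 0.
Proof.
have hq : asymp2 r (head q q) Q.
  by rewrite -(mul1r Q); apply: asymp2_head => //; exact: cq.1.
have := asymp2_mid _ _ _ _ _ _ r0 cq cq hq hq qq.
by rewrite (_ : 2 * Q - (Q + Q) = 0)%R//; lra.
Qed.

(** Since [l x f <= x q], it suffices to treat [mid (mulid q) q], which by symmetry is half of [x]
    times [mid q q]. *)
Let mid_Dfq : asymp2 s (mid (mulid f) q) 0.
Proof.
have cDq := causal_mulid _ cq.
apply: asymp2_midC; [exact: cq.1|exact: cDf.1|].
apply: (@mid0_le _ _ _ _ (mulid q) l^-1) => //.
- exact: cq.1.
- exact: cDf.1.
- exact: cDq.1.
- by rewrite invr_ge0.
- near=> x; have x0 : (0 <= x)%R by near: x; exact: nbhs_pinfty_ge.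
  rewrite /mulid muleCA; apply: lee_wpmul2l; first by rewrite lee_fin.
  by rewrite -[leLHS]mul1e -(mulVf (lt0r_neq0 l0)) EFinM -muleA lee_wpmul2l// lee_fin invr_ge0.
- apply: asymp2_midC; [exact: cDq.1|exact: cq.1|].
  rewrite -(mul0r 2^-1%R); exact: (asymp2_mid_mulid _ _ _ cq).1.
Unshelve. all: end_near. Qed.

Let head_qDf : asymp2 s (head q (mulid f)) 0.
Proof.
apply: asymp2_head0 => //; [exact: asymp_idmul0 qr|exact: cq.1|exact: cDf.1|].
by move=> A; exact: fin_integral_window_mulid f1.
Qed.

(** A cancellation in [\bar R] where only the subtracted terms are known to be finite. *)
Let window_algebra (F H1 H2 M : \bar R) (k : R) : 0 <= F -> 0 <= H1 -> 0 <= H2 -> 0 <= M ->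
  l%:E * (H2 * k%:E) + l%:E * (M * k%:E) \is a fin_num ->
  (l%:E * F + l%:E * (H1 + H2 + M)) * k%:E - (l%:E * (H2 * k%:E) + l%:E * (M * k%:E)) =
  l%:E * F * k%:E + l%:E * H1 * k%:E.
Proof.
move=> F0 H10 H20 M0; have lp : 0 <= l%:E by rewrite lee_fin.
have H120 := adde_ge0 H10 H20.
have [lF lH1] := (mule_ge0 lp F0, mule_ge0 lp H10).
have [lH2 lM] := (mule_ge0 lp H20, mule_ge0 lp M0).
rewrite (ge0_muleDr _ H120 M0) (ge0_muleDr _ H10 H20).
have lH12 := adde_ge0 lH1 lH2.
rewrite (ge0_muleDl _ lF (adde_ge0 lH12 lM)) (ge0_muleDl _ lH12 lM) (ge0_muleDl _ lH1 lH2).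
rewrite !(muleA l%:E) => fin.
by rewrite -(addeA (_ * H1 * _)) (addeA (_ * F * _)) addeK.
Qed.

Let W (z : R * R) := l%:E * head (mulid f) q z.1 z.2 * ((s z.2)^-1)%:E.

(** The identity for [x q] divided by [x r(x)], after its negligible head and middle range are
    subtracted. *)
Let W_cvg : (rho z.2 + W z) @[z --> iter_pinfty] --> 1%:E.
Proof.
have Dq : asymp s (mulid q) 1 by exact: (asymp_mulid _ _ _).1.
have t1 : (l%:E * (head q (mulid f) z.1 z.2 * ((s z.2)^-1)%:E)) @[z --> iter_pinfty] --> l%:E * 0.
  exact: cvgeZl.
have t2 : (l%:E * (mid (mulid f) q z.1 z.2 * ((s z.2)^-1)%:E)) @[z --> iter_pinfty] --> l%:E * 0.
  exact: cvgeZl.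
rewrite mule0 in t1 t2.
have t12 : (l%:E * (head q (mulid f) z.1 z.2 * ((s z.2)^-1)%:E) +
    l%:E * (mid (mulid f) q z.1 z.2 * ((s z.2)^-1)%:E)) @[z --> iter_pinfty] --> 0%:E.
  by rewrite -[X in _ --> X]adde0; apply: cvgeD.
have Dq2 := (asymp2_asymp s (mulid q) 1).2 Dq; rewrite /asymp2 in Dq2.
have D12 : (mulid q z.2 * ((s z.2)^-1)%:E -
    (l%:E * (head q (mulid f) z.1 z.2 * ((s z.2)^-1)%:E) +
    l%:E * (mid (mulid f) q z.1 z.2 * ((s z.2)^-1)%:E))) @[z --> iter_pinfty] --> 1%:E.
  by rewrite -[X in _ --> X]sube0; apply: cvgeB.
apply: cvg_trans D12; apply: near_eq_cvg.
have Hrho := near_iter_snd _ rhoE; have Hs := near_iter_snd _ s0.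
have /fine_cvgP[F12 _] := t12.
have HA := @near_iter_window R.
near=> z; have [A0 Ax] : (0 < z.1 /\ z.1 + z.1 <= z.2)%R by near: z.
have sz : (0 < s z.2)%R by near: z.
have rz : rho z.2 = l%:E * mulid f z.2 * ((s z.2)^-1)%:E by near: z.
have fz : l%:E * (head q (mulid f) z.1 z.2 * ((s z.2)^-1)%:E) +
  l%:E * (mid (mulid f) q z.1 z.2 * ((s z.2)^-1)%:E) \is a fin_num by near: z.
rewrite /= rz /W mulid_cexp// (fconv_split _ _ z.1 z.2 cDf cq A0 Ax).
have p1 := head_ge0 _ _ z.1 z.2 cDf.1 cq.1; have p2 := head_ge0 _ _ z.1 z.2 cq.1 cDf.1.
have p3 := mid_ge0 _ _ z.1 z.2 cDf.1 cq.1.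
have p0 : 0 <= mulid f z.2 by exact: cDf.1.2.
by rewrite window_algebra.
Unshelve. all: end_near. Qed.

Let V_le_Q A x : head rho q A x <= Q%:E.
Proof.
rewrite -qQ.
apply: (@le_trans _ _ (\int[mu]_(u in `[0%R, A[) q u)); last first.
  by apply: ge0_subset_integral => //; [exact: cq.1.1|move=> u _; exact: cq.1.2].
have nrq : nonneg_measurable (fun u => rho (x - u)%R * q u).
  apply: nonneg_measurableM; last exact: cq.1.
  exact: nonneg_measurable_reflect.
apply: ge0_le_integral => //.
- by move=> u _; exact: nrq.2.
- exact: measurable_funS nrq.1.
- exact: measurable_funS cq.1.1.
- move=> u _; rewrite -[leRHS]mul1e; apply: lee_wpmul2r; last exact: rho_le1.
  exact: cq.1.2.
Qed.

(** [W] divides [l (x - u) f(x - u)] by [s x], while [rho (x - u)] divides it by [s (x - u)]; for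
    [u] in a bounded window the long tail of [s] makes the quotient of the two uniformly close to
    1. *)
Let WV e : (0 < e < 1)%R -> \forall z \near iter_pinfty,
  (1 - e)%:E * head rho q z.1 z.2 <= W z <= (1 + e)%:E * head rho q z.1 z.2.
Proof.
move=> /andP[e0 e1]; exists (0 : R)%R; split => // A A0.
have [M [_ MP]] : \forall x \near +oo%R, rho x = l%:E * mulid f x * ((s x)^-1)%:E /\ (0 < s x)%R.
  exact: filterI.
near=> x; rewrite /W /=.
have sx : (0 < s x)%R by near: x.
have unif : forall u, (0 <= u <= A)%R -> (`|s (x - u) / s x - 1| <= e)%R.
  by near: x; exact: long_tailed_uniform.
have xM : (M + A <= x)%R by near: x; apply: nbhs_pinfty_ge; exact: num_real.
have bnd u : (0 <= u < A)%R ->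
  (1 - e)%:E * rho (x - u)%R <= l%:E * mulid f (x - u)%R * ((s x)^-1)%:E
    <= (1 + e)%:E * rho (x - u)%R.
  move=> /andP[u0 uA]; have [rE sxu] := MP (x - u)%R ltac:(lra).
  have -> : l%:E * mulid f (x - u)%R = rho (x - u)%R * (s (x - u))%:E.
    by rewrite rE -muleA -EFinM mulVf ?mule1 ?gt_eqF.
  have rn : (0 <= rho_r (x - u))%R by rewrite -lee_fin; exact: rho_nonneg.2.
  have := unif u; rewrite u0 ltW// => /(_ isT); rewrite ler_distl => /andP[h1 h2].
  rewrite /rho -!EFinM !lee_fin -mulrA (mulrC (1 - e)%R) (mulrC (1 + e)%R).
  by apply/andP; split; exact: ler_wpM2l.
have nf1 : nonneg_measurable (fun u => mulid f (x - u)%R * q u).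
  apply: nonneg_measurableM; last exact: cq.1.
  by apply: nonneg_measurable_reflect; exact: cDf.1.
have nf2 : nonneg_measurable (fun u => rho (x - u)%R * q u).
  apply: nonneg_measurableM; last exact: cq.1.
  exact: nonneg_measurable_reflect.
have k0 : (0 <= l / s x)%R by rewrite divr_ge0// ltW.
have -> : l%:E * head (mulid f) q A x * ((s x)^-1)%:E =
    \int[mu]_(u in `[0%R, A[) ((l / s x)%:E * (mulid f (x - u)%R * q u)).
  rewrite ge0_integralZl_EFin//; last 2 first.
  - by move=> u _; exact: nf1.2.
  - exact: measurable_funS nf1.1.
  by rewrite EFinM muleAC.
have i2 k : (0 <= k)%R -> k%:E * head rho q A x =
    \int[mu]_(u in `[0%R, A[) (k%:E * (rho (x - u)%R * q u)).
  move=> kp; rewrite ge0_integralZl_EFin//.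
  - by move=> u _; exact: nf2.2.
  - exact: measurable_funS nf2.1.
have m1 k : measurable_fun `[0%R, A[ (fun u => k%:E * (mulid f (x - u)%R * q u)).
  by apply: measurable_funeM; apply: measurable_funS nf1.1.
have m2 k : measurable_fun `[0%R, A[ (fun u => k%:E * (rho (x - u)%R * q u)).
  by apply: measurable_funeM; apply: measurable_funS nf2.1.
rewrite !i2; [|lra..].
have pt u : (0 <= u < A)%R ->
  (1 - e)%:E * (rho (x - u)%R * q u) <= (l / s x)%:E * (mulid f (x - u)%R * q u)
    <= (1 + e)%:E * (rho (x - u)%R * q u).
  move=> /bnd/andP[h1 h2].
  have -> : (l / s x)%:E * (mulid f (x - u)%R * q u) =
      l%:E * mulid f (x - u)%R * ((s x)^-1)%:E * q u.
    move: (mulid f _) (q u) => m v; rewrite (EFinM l) -!muleA; congr (_ * _).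
    exact: muleCA.
  rewrite (muleA (1 - e)%:E) (muleA (1 + e)%:E).
  by apply/andP; split; apply: lee_wpmul2r => //; exact: cq.1.2.
apply/andP; split; apply: ge0_le_integral => //.
- by move=> u _; apply: mule_ge0; [rewrite lee_fin; lra|exact: nf2.2].
- exact: m2.
- exact: m1.
- by move=> u; rewrite /= in_itv/= => /pt/andP[].
- by move=> u _; apply: mule_ge0; [rewrite lee_fin|exact: nf1.2].
- exact: m1.
- exact: m2.
- by move=> u; rewrite /= in_itv/= => /pt/andP[].
Unshelve. all: end_near. Qed.

Let V_cvg : (rho z.2 + head rho q z.1 z.2) @[z --> iter_pinfty] --> 1%:E.
Proof.
apply/cvg_EFin_bounds => e e0.
have Q0 : (0 < Q + 1)%R.
  have : (0 <= Q)%R by rewrite subr_ge0 -expR0 ler_expR.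
  lra.
have Qp : (0 <= Q)%R by rewrite subr_ge0 -expR0 ler_expR.
(* Replacing [W] by [head rho q], which is at most [Q], costs at most [d * Q <= e / 2]; the cap
   [1/2] gives the [d < 1] that [WV] asks for. *)
pose d := Num.min 2^-1%R (e / 2 / (Q + 1))%R.
have d0 : (0 < d)%R by rewrite lt_min invr_gt0 ltr0n !divr_gt0.
have d1 : (0 < d < 1)%R.
  rewrite d0 /d gt_min; apply/orP; left; lra.
have dQ : (d * Q <= e / 2)%R.
  apply: (@le_trans _ _ (d * (Q + 1))%R); first by rewrite ler_pM2l// lerDl.
  by rewrite -ler_pdivlMr// /d ge_min lexx orbT.
have e2 : (0 < e / 2)%R by rewrite divr_gt0.
have /cvg_EFin_bounds/(_ _ e2) H1 := W_cvg.
have H2 := WV d d1.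
near=> z.
have /andP[h1 h2] : (1 - d)%:E * head rho q z.1 z.2 <= W z <= (1 + d)%:E * head rho q z.1 z.2.
  by near: z.
have /andP[h3 h4] : (1 - e / 2)%:E <= rho z.2 + W z <= (1 + e / 2)%:E by near: z.
have V0 : 0 <= head rho q z.1 z.2 by apply: head_ge0 => //; exact: cq.1.
have VQ := V_le_Q z.1 z.2.
have Vf : head rho q z.1 z.2 \is a fin_num.
  by rewrite ge0_fin_numE// (le_lt_trans VQ) ?ltry.
have Wf : W z \is a fin_num.
  rewrite fin_numElt (@lt_le_trans _ _ ((1 - d)%:E * head rho q z.1 z.2))//=.
    by rewrite (le_lt_trans h2)// -(fineK Vf) -EFinM ltry.
  by rewrite -(fineK Vf) -EFinM ltNyr.
move: h1 h2 h3 h4 V0 VQ; rewrite /rho -(fineK Vf) -(fineK Wf).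
rewrite -!EFinM -!EFinD !lee_fin.
move: (fine (head _ _ _ _)) (fine (W z)) (rho_r z.2) => v w t h1 h2 h3 h4 V0 VQ.
have dv : (d * v <= d * Q)%R by rewrite ler_pM2l.
have dv0 : (0 <= d * v)%R by rewrite mulr_ge0// ltW.
by apply/andP; split; lra.
Unshelve. all: end_near. Qed.

Lemma asymp_deconvolution : asymp r f (expR (- l) / l).
Proof.
have H : (rho x + fconv rho q x) @[x --> +oo%R] --> 1%:E.
  by apply: (cvg_add_fconv _ _ _ 1 Q) => //.
have := exp_deconvolution f rho l cf f1 l0 rho_nonneg rho_le1 H.
move=> /(cvgeZl (y := (l^-1)%:E) isT); rewrite -EFinM mulrC.
apply: cvg_trans; apply: near_eq_cvg; near=> x.
have fx : f x \is a fin_num by near: x.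
rewrite -(fineK fx) /rho -!EFinM; congr EFin; rewrite /rho_r -mulrA mulKf//.
by rewrite gt_eqF.
Unshelve. all: end_near. Qed.
End deconvolution.

(** * Kesten's bound *)

Section kesten_bound.
Context {R : realType}.
Local Notation mu := (@lebesgue_measure R).

(** Pointwise [a b <= (a^2 + b^2) / 2], and the two squares have the same integral by reflection. *)
Lemma fconv_square_le (phi : R -> R) (x : R) : nonneg_measurable (EFin \o phi) ->
  fconv (EFin \o phi) (EFin \o phi) x <= \int[mu]_u ((phi u) ^+ 2)%:E.
Proof.
move=> [mphi phi0].
have m2 : nonneg_measurable (fun u => ((phi u) ^+ 2)%:E).
  split; last by move=> u; rewrite lee_fin sqr_ge0.
  by apply/measurable_EFinP/measurable_funX; exact/measurable_EFinP.
have [[m2m m20] [mr r0]] := (m2, nonneg_measurable_reflect _ x m2).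
have [mr1 r10] := nonneg_measurable_reflect _ x (conj mphi phi0).
have half : (2^-1 : R)%:E * (\int[mu]_u ((phi u) ^+ 2)%:E + \int[mu]_u ((phi u) ^+ 2)%:E) =
    \int[mu]_u ((phi u) ^+ 2)%:E.
  by rewrite -mule2n -mule_natl muleA -EFinM mulVf// mul1e.
rewrite -half -{1}(integral_reflect _ x m2) -ge0_integralD//.
rewrite -ge0_integralZl_EFin//; last 2 first.
- by move=> u _; exact: adde_ge0.
- exact: emeasurable_funD.
apply: ge0_le_integral => //.
- by move=> u _; apply: mule_ge0; [exact: r10|exact: phi0].
- exact: emeasurable_funM.
- by apply: measurable_funeM; exact: emeasurable_funD.
- move=> u _ /=; rewrite -EFinM -EFinD -EFinM lee_fin.
  have := sqr_ge0 (phi (x - u) - phi u)%R; rewrite sqrrB; lra.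
Qed.

Variables (r : R -> R) (f : R -> \bar R) (M : R).
Hypotheses (lr : long_tailed r) (cf : causal f) (f1 : \int[mu]_x f x = 1)
  (fr : \forall x \near +oo%R, f x = (r x)%:E)
  (ff : asymp r (fconv f f) 2) (ffM : forall x, fconv f f x <= M%:E).

Let P n := fconv_power f n.+1.
Let cP n : causal (P n). Proof. exact: causal_fconv_power. Qed.
Let P1 n : \int[mu]_x P n x = 1. Proof. exact: integral_fconv_power. Qed.

Let fconv_le_of_le (h : R -> \bar R) c x : nonneg_measurable h -> (0 <= c)%R ->
  (forall y, h y <= c%:E) -> fconv f h x <= c%:E.
Proof.
move=> nh c0 hc; rewrite fconvC//; last exact: cf.1.
have [mh h0] := nonneg_measurable_reflect _ x nh.
apply: (@le_trans _ _ (\int[mu]_u (c%:E * f u))).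
  apply: ge0_le_integral => //.
  - by move=> u _; apply: mule_ge0; [exact: h0|exact: cf.1.2].
  - by apply: emeasurable_funM => //; exact: cf.1.1.
  - by apply: measurable_funeM; exact: cf.1.1.
  - by move=> u _; apply: lee_wpmul2r => //; exact: cf.1.2.
rewrite ge0_integralZl_EFin ?f1 ?mule1//; last exact: cf.1.1.
by move=> u _; exact: cf.1.2.
Qed.

Let PM n x : P n.+1 x <= M%:E.
Proof.
elim: n x => [|n ih] x; first exact: ffM.
apply: fconv_le_of_le => //; first exact: (cP n.+1).1.
by rewrite -lee_fin; apply: le_trans (ffM 0%R); exact: (cP 1).1.2.
Qed.

(** The half-line [x > x0] must not depend on [n], for the induction to reach every [u > x0] inside
    the convolution. For [x >= x1] the convolution is split at [u = x0]; between [x0] and [x1] the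
    common bound [M] of the powers is set against a positive lower bound of [r]. *)
Lemma kesten_bound : exists K : R, (0 <= K)%R /\ \forall x \near +oo%R, forall n,
  P n x <= (K * 5 ^+ n)%:E * f x.
Proof.
have [mr r0 _] := lr.
have ff3 : \forall x \near +oo%R, fconv f f x <= (3 * r x)%:E.
  have := (asympP r _ _ r0).1 ff 1%R ltr01.
  apply: filterS => x /andP[_]; rewrite (_ : 2 + 1 = 3 :> R)%R//; lra.
have U1 : \forall x \near +oo%R, forall u, (0 <= u <= 1)%R -> (`|r (x - u) / r x - 1| <= 2^-1)%R.
  by apply: long_tailed_uniform => //; rewrite invr_gt0.
have [N [_ NP]] : \forall x \near +oo%R, [/\ f x = (r x)%:E, (0 < r x)%R,
    fconv f f x <= (3 * r x)%:E &
    forall u, (0 <= u <= 1)%R -> (`|r (x - u) / r x - 1| <= 2^-1)%R].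
  by near=> x; split; near: x.
pose x0 := (Num.max N 0 + 1)%R.
have [x00 x0N] : (0 < x0)%R /\ (N < x0)%R.
  by rewrite /x0; case: (lerP N 0) => ?; split; lra.
have HP x : (x0 <= x)%R -> [/\ f x = (r x)%:E, (0 < r x)%R,
    fconv f f x <= (3 * r x)%:E &
    forall u, (0 <= u <= 1)%R -> (`|r (x - u) / r x - 1| <= 2^-1)%R].
  by move=> x0x; apply: NP; exact: lt_le_trans x0x.
(* [r] need not be continuous, so its lower bound on a bounded interval comes from unit steps:
   [r (x - u) <= 3/2 * r x] for [0 <= u <= 1]. The step [Num.min 1 (x - x0)] never goes below
   [x0]. *)
have lower k x : (x0 <= x <= x0 + k%:R)%R -> ((2 / 3) ^+ k * r x0 <= r x)%R.
  elim: k x => [|k ih] x /andP[xl xu].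
    by rewrite expr0 mul1r (_ : x = x0)//; apply: le_anti; rewrite xl -(addr0 x0) xu.
  pose u := Num.min 1%R (x - x0)%R.
  have u01 : (0 <= u <= 1)%R by rewrite le_min ler01 subr_ge0 xl ge_min lexx.
  have xuP : (x0 <= x - u <= x0 + k%:R)%R.
    rewrite -natr1 in xu; have := ler0n R k.
    by rewrite /u; case: (lerP 1 (x - x0)%R) => ? ?; apply/andP; split; lra.
  have [_ rx _ /(_ u u01)] := HP x xl.
  rewrite ler_distl => /andP[_]; rewrite ler_pdivrMr// => h.
  have := ih _ xuP; rewrite exprS -mulrA => h2.
  by move: (((2 / 3) ^+ k * r x0)%R) h2 => t h2; lra.
have [L [_ LP]] : \forall x \near +oo%R,
    forall u, (0 <= u <= x0)%R -> (`|r (x - u) / r x - 1| <= 1)%R.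
  exact: long_tailed_uniform.
(* [2 * x0 <= x1] ensures [x - u >= x0] for [u <= x0], and [L < x1] gives [r (x - u) <= 2 * r x]
   there. *)
pose x1 := (Num.max L (x0 + x0) + 1)%R.
have [x1L x10] : (L < x1)%R /\ (x0 + x0 <= x1)%R.
  by rewrite /x1; case: (lerP L (x0 + x0)%R) => ?; split; lra.
pose k1 := (Num.truncn (x1 - x0)).+1.
have x1k : (x1 <= x0 + k1%:R)%R.
  by rewrite -lerBlDl ltW// truncnS_gt.
pose dl := ((2 / 3) ^+ k1 * r x0)%R.
have dl0 : (0 < dl)%R.
  have [_ ? _ _] := HP x0 (lexx _).
  by rewrite mulr_gt0// exprn_gt0.
(* [K >= 1] serves the first power and absorbs the term free of [K] in the induction; [M <= K * dl]
   settles the bounded range. *)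
pose K := Num.max 1%R (M / dl)%R.
have K1 : (1 <= K)%R by rewrite le_max lexx.
have KM : (M <= K * dl)%R by rewrite -ler_pdivrMr// le_max lexx orbT.
have K0 : (0 <= K)%R by exact: le_trans K1.
have pow5 n : (1 <= 5 ^+ n :> R)%R by rewrite exprn_ege1// ler1n.
exists K; split => //; exists x0; split; first exact: num_real.
move=> x x0x n; elim: n x x0x => [|n ih] x /ltW x0x.
  rewrite expr0 mulr1 -[leLHS]mul1e; apply: lee_wpmul2r; first exact: cf.1.2.
  by rewrite lee_fin.
have [fx rx ff3x _] := HP x x0x.
have [xx1|xx1] := ltP x x1.
  apply: (le_trans (PM n x)); rewrite fx -EFinM lee_fin.
  apply: (le_trans KM); rewrite -mulrA; apply: ler_wpM2l => //.
  have dr : (dl <= r x)%R by apply: lower; rewrite x0x (le_trans (ltW xx1)).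
  apply: (le_trans dr); rewrite ler_peMl// ltW//.
have xL : (L < x)%R by exact: lt_le_trans xx1.
have c5 : (0 <= K * 5 ^+ n)%R by rewrite mulr_ge0// exprn_ge0.
have [mfx fx0] := nonneg_measurable_reflect _ x cf.1.
have nPn := (cP n).1.
(* Long-tailedness bounds [f (x - u)] for [u <= x0], the induction hypothesis
   bounds [P n u] for [u > x0]. *)
have bound u : f (x - u)%R * P n u <=
    (2 * r x)%:E * P n u + (K * 5 ^+ n)%:E * (f (x - u)%R * f u).
  have [u0|u0] := ltP u 0%R.
    rewrite (cP n).2// !mule0 add0e; apply: mule_ge0; first by rewrite lee_fin.
    by apply: mule_ge0; [exact: fx0|exact: cf.1.2].
  have [ux0|ux0] := ltP x0 u.
    apply: (@le_trans _ _ ((K * 5 ^+ n)%:E * (f (x - u)%R * f u))).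
      rewrite muleCA; apply: lee_wpmul2l; first exact: fx0.
      exact: ih.
    rewrite leeDr// mule_ge0//; last exact: nPn.2.
    by rewrite lee_fin mulr_ge0// ltW.
  have xu0 : (x0 <= x - u)%R by lra.
  have [fxu _ _ _] := HP _ xu0.
  apply: (@le_trans _ _ ((2 * r x)%:E * P n u)).
    apply: lee_wpmul2r; first exact: nPn.2.
    rewrite fxu lee_fin; have := LP x xL u; rewrite u0 ux0 => /(_ isT).
    by rewrite ler_distl => /andP[_]; rewrite ler_pdivrMr.
  rewrite leeDl//; apply: mule_ge0; first by rewrite lee_fin.
  by apply: mule_ge0; [exact: fx0|exact: cf.1.2].
have r20 : (0 <= 2 * r x)%R by rewrite mulr_ge0// ltW.
(* The origin of 5: the window gives 2, [f * f <= 3 r] gives 3, and [2 + 3 t <= 5 t] for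
   [t = K * 5 ^+ n >= 1]. *)
apply: (@le_trans _ _ ((2 * r x)%:E + (K * 5 ^+ n)%:E * (3 * r x)%:E)); last first.
  rewrite fx -!EFinM -EFinD lee_fin exprS.
  have : (0 <= (K * 5 ^+ n - 1) * r x)%R.
    by apply: mulr_ge0; [rewrite subr_ge0 mulr_ege1|exact: ltW].
  by move: (5 ^+ n)%R => t; nra.
apply: (@le_trans _ _ ((2 * r x)%:E * \int[mu]_u P n u + (K * 5 ^+ n)%:E * fconv f f x)); last first.
  by rewrite P1 mule1 leeD2l// lee_wpmul2l.
rewrite /fconv -!ge0_integralZl_EFin//; first last.
- exact: nPn.1.
- by move=> u _; exact: nPn.2.
- by apply: emeasurable_funM => //; exact: cf.1.1.
- by move=> u _; apply: mule_ge0; [exact: fx0|exact: cf.1.2].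
rewrite -ge0_integralD//; first last.
- by apply: measurable_funeM; apply: emeasurable_funM => //; exact: cf.1.1.
- move=> u _; apply: mule_ge0; first by rewrite lee_fin.
  by apply: mule_ge0; [exact: fx0|exact: cf.1.2].
- by apply: measurable_funeM; exact: nPn.1.
- by move=> u _; apply: mule_ge0; [rewrite lee_fin|exact: nPn.2].
apply: ge0_le_integral => //.
- by move=> u _; apply: mule_ge0; [exact: fx0|exact: nPn.2].
- by apply: emeasurable_funM => //; exact: nPn.1.
- apply: emeasurable_funD; apply: measurable_funeM; first exact: nPn.1.
  by apply: emeasurable_funM => //; exact: cf.1.1.
Unshelve. all: end_near. Qed.

Lemma cexp_bound (l : R) : (0 <= l)%R -> exists k : R, (0 <= k)%R /\
  \forall x \near +oo%R, cexp l f x <= k%:E * f x.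
Proof.
move=> l0; have [K [K0 KP]] := kesten_bound.
have l50 : (0 <= 5 * l)%R by rewrite mulr_ge0.
exists (K * expR (5 * l))%R; split; first by rewrite mulr_ge0 ?expR_ge0.
near=> x; have Px : forall n, P n x <= (K * 5 ^+ n)%:E * f x by near: x.
have fx : f x = (r x)%:E by near: x.
have rx0 : (0 <= r x)%R by rewrite -lee_fin -fx; exact: cf.1.2.
have Kr : (0 <= K * r x)%R by rewrite mulr_ge0.
(* [5 ^+ n] is weakened to [5 ^+ n.+1], which leaves the exponential series at [5 * l] without its
   first term. *)
apply: (@le_trans _ _ (\sum_(0 <= n <oo) ((K * r x)%:E * (poisson_coef (5 * l) n.+1)%:E))).
  apply: lee_nneseries => [n _ _|n _]; first exact: (causal_cexp_term _ _ _ l0 cf).1.2.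
  apply: (@le_trans _ _ ((poisson_coef l n.+1)%:E * ((K * 5 ^+ n)%:E * f x))).
    by apply: lee_wpmul2l; [rewrite lee_fin; exact: poisson_coef_ge0|exact: Px].
  rewrite fx -!EFinM lee_fin.
  have -> : (K * r x * poisson_coef (5 * l) n.+1 =
      5 * (poisson_coef l n.+1 * (K * 5 ^+ n * r x)))%R.
    by rewrite /poisson_coef exprMn exprS; ring.
  apply: ler_peMl; last by rewrite ler1n.
  apply: mulr_ge0; first exact: poisson_coef_ge0.
  by apply: mulr_ge0 => //; apply: mulr_ge0 => //; exact: exprn_ge0.
rewrite nneseriesZl; last by move=> n _; rewrite lee_fin poisson_coef_ge0.
have -> : (K * expR (5 * l))%:E * f x = (K * r x)%:E * (expR (5 * l))%:E.
  by rewrite fx -!EFinM mulrAC.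
apply: lee_wpmul2l; first by rewrite lee_fin.
rewrite -(nneseries_exp (5 * l))// [leRHS]nneseries_recl1; last first.
  by move=> n; rewrite lee_fin; exact: poisson_coef_ge0.
by rewrite leeDr// lee_fin; exact: (poisson_coef_ge0 _ 0).
Unshelve. all: end_near. Qed.
End kesten_bound.

(** * The theorem *)

Section equivalence_of_asymptotics.
Context {R : realType}.
Local Notation mu := (@lebesgue_measure R).
Implicit Types (f g F G : R -> \bar R) (r : R -> R).

Lemma near_pinftyP (P : R -> Prop) : (\forall x \near +oo%R, P x) <->
  exists A : R, forall x, (A <= x)%R -> P x.
Proof.
split=> [[M [_ MP]]|[A AP]].
  by exists (M + 1)%R => x Mx; apply: MP; rewrite (lt_le_trans _ Mx)// ltrDl.
by exists A; split; [exact: num_real|move=> x /ltW /AP].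
Qed.

Lemma fin_numPlty (x : \bar R) : 0 < x < +oo -> x \is a fin_num.
Proof. by move=> /andP[/ltW x0]; rewrite ge0_fin_numE. Qed.

Lemma asymp_asym_equiv r F G a : eventually_pos r -> (0 < a)%R ->
  asymp r F a -> asymp r G a -> asym_equiv F G.
Proof.
move=> r0 a0 /fine_cvgP[F1 F2] /fine_cvgP[G1 G2].
have key H : (\forall x \near +oo%R, H x * ((r x)^-1)%:E \is a fin_num) ->
    (fine (H x * ((r x)^-1)%:E) @[x --> +oo%R] --> a) ->
    \forall x \near +oo%R, H x = (fine (H x * ((r x)^-1)%:E) * r x)%:E /\
      (0 < fine (H x * ((r x)^-1)%:E))%R.
  move=> H1 H2.
  have H3 : \forall x \near +oo%R, (0 < fine (H x * ((r x)^-1)%:E))%R by exact: cvgr_gt H2 _ a0.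
  near=> x.
  have rx : (0 < r x)%R by near: x.
  have fx : H x * ((r x)^-1)%:E \is a fin_num by near: x.
  split; last by near: x.
  by rewrite EFinM fineK// -muleA -EFinM mulVf ?mule1 ?gt_eqF.
have KF := key F F1 F2; have KG := key G G1 G2.
split.
  apply/near_pinftyP; near=> x.
  have rx : (0 < r x)%R by near: x.
  have [eF pF] : F x = (fine (F x * ((r x)^-1)%:E) * r x)%:E /\
      (0 < fine (F x * ((r x)^-1)%:E))%R by near: x.
  have [eG pG] : G x = (fine (G x * ((r x)^-1)%:E) * r x)%:E /\
      (0 < fine (G x * ((r x)^-1)%:E))%R by near: x.
  by rewrite eF eG !lte_fin !ltry !mulr_gt0.
have FG : (fine (F x * ((r x)^-1)%:E) / fine (G x * ((r x)^-1)%:E))%R @[x --> +oo%R] --> (1 : R)%R.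
  rewrite -(divff (lt0r_neq0 a0)); apply: cvgM => //; apply: cvgV => //.
  by rewrite gt_eqF.
apply: cvg_trans FG; apply: near_eq_cvg; near=> x.
have rx : (r x != 0)%R by rewrite gt_eqF//; near: x.
have [eF pF] : F x = (fine (F x * ((r x)^-1)%:E) * r x)%:E /\
    (0 < fine (F x * ((r x)^-1)%:E))%R by near: x.
have [eG pG] : G x = (fine (G x * ((r x)^-1)%:E) * r x)%:E /\
    (0 < fine (G x * ((r x)^-1)%:E))%R by near: x.
rewrite [in RHS]eF [in RHS]eG /=.
by rewrite invfM mulrACA divff// mulr1.
Unshelve. all: end_near. Qed.

Lemma asym_equiv_asymp r F G a : asym_equiv F G -> asymp r G a -> asymp r F a.
Proof.
move=> [/near_pinftyP FG0 FG] Ga.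
have FGe : (fine (F x) / fine (G x))%:E @[x --> +oo%R] --> (1 : R)%:E.
  by apply/fine_cvgP; split; [exact: nearW|].
rewrite /asymp -[X in _ --> X]mul1e; apply: cvg_trans (cvgeM _ FGe Ga) => //.
apply: near_eq_cvg; near=> x.
have [Fx Gx] : 0 < F x < +oo /\ 0 < G x < +oo by near: x.
have [fF fG] := (fin_numPlty _ Fx, fin_numPlty _ Gx).
have G0 : (fine (G x) != 0)%R by rewrite gt_eqF// fine_gt0.
rewrite /= muleA; congr (_ * _).
by rewrite -[in X in _ * X](fineK fG) -EFinM divfK// fineK.
Unshelve. all: end_near. Qed.

Lemma asymp_rescale r1 r2 F (a k : R) : (k != 0)%R ->
  (\forall x \near +oo%R, r2 x = k * r1 x)%R -> asymp r1 F a -> asymp r2 F (a / k).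
Proof.
move=> k0 r12 /(asympZ _ _ k^-1); rewrite mulrC; apply: cvg_trans.
apply: near_eq_cvg; near=> x; rewrite (near r12 x)// invfM EFinM muleA.
by rewrite (muleC (k^-1)%:E).
Unshelve. all: end_near. Qed.

Lemma class_L_long_tailed g : class_L g ->
  long_tailed (fine \o g) /\ \forall x \near +oo%R, g x = (fine (g x))%:E.
Proof.
move=> [[mg g0] gL].
have [/near_pinftyP g1 _] := gL 0%R.
split; last first.
  by apply: filterS g1 => x [_ /fin_numPlty/fineK].
split.
- by apply: (@measurableT_comp _ _ _ _ _ _ fine _ g); [exact: fine_measurable|].
- by apply: filterS g1 => x [_]; exact: fine_gt0.
- by move=> a; have [_] := gL a.
Qed.

Lemma long_tailed_class_L g : nonneg_measurable g -> long_tailed (fine \o g) ->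
  (\forall x \near +oo%R, g x = (fine (g x))%:E) -> class_L g.
Proof.
move=> ng [_ g0 gL] gE; split => // a; split; last exact: gL.
have P : \forall x \near +oo%R, 0 < g x < +oo.
  near=> x; have -> : g x = (fine (g x))%:E by near: x.
  by rewrite lte_fin ltry andbT; near: x.
by apply/near_pinftyP; apply: filterI => //; exact: (near_pinftyD (fun x => 0 < g x < +oo)).
Unshelve. all: end_near. Qed.

(** [g (x + a) / g x] is the product of [g / r] at [x + a], [r (x + a) / r x] and [r / g] at [x],
    whose limits are [C], 1 and [1 / C]. *)
Lemma long_tailed_asymp r g (C : R) : long_tailed r -> nonneg_measurable g ->
  (0 < C)%R -> asymp r g C ->
  long_tailed (fine \o g) /\ \forall x \near +oo%R, g x = (fine (g x))%:E.
Proof.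
move=> [mr r0 rL] [mg g0] C0 /fine_cvgP[G1 G2].
have G3 : \forall x \near +oo%R, (0 < fine (g x * ((r x)^-1)%:E))%R by exact: cvgr_gt G2 _ C0.
have KG : \forall x \near +oo%R, [/\ g x = (fine (g x))%:E, (0 < fine (g x))%R &
    fine (g x * ((r x)^-1)%:E) = (fine (g x) / r x)%R].
  near=> x; have rx : (0 < r x)%R by near: x.
  have fx : g x * ((r x)^-1)%:E \is a fin_num by near: x.
  have px : (0 < fine (g x * ((r x)^-1)%:E))%R by near: x.
  have gx : g x = (fine (g x * ((r x)^-1)%:E) * r x)%:E.
    by rewrite EFinM fineK// -muleA -EFinM mulVf ?mule1 ?gt_eqF.
  by split; rewrite gx//= ?mulr_gt0// mulfK ?gt_eqF.
have gE : \forall x \near +oo%R, g x = (fine (g x))%:E by apply: filterS KG => x [].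
split => //; split.
- by apply: (@measurableT_comp _ _ _ _ _ _ fine _ g); [exact: fine_measurable|].
- by apply: filterS KG => x [].
move=> a.
have rho : (fine (g x) / r x)%R @[x --> +oo%R] --> C.
  by apply: cvg_trans G2; apply: near_eq_cvg; apply: filterS KG => x [].
have rhoa : (fine (g (x + a)) / r (x + a))%R @[x --> +oo%R] --> C.
  by move=> U /rho; exact: near_pinftyD.
have : ((fine (g (x + a)) / r (x + a)) * (r (x + a) / r x) / (fine (g x) / r x))%R
    @[x --> +oo%R] --> (C * 1 / C)%R.
  apply: cvgM; first exact: cvgM.
  by apply: cvgV => //; rewrite gt_eqF.
rewrite mulr1 divff ?gt_eqF//; apply: cvg_trans; apply: near_eq_cvg.
have r0a := near_pinftyD _ a r0.
near=> x.
have rx : (r x != 0)%R by rewrite gt_eqF//; near: x.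
have rxa : (r (x + a) != 0)%R by rewrite gt_eqF//; near: x.
have gx : (fine (g x) != 0)%R.
  by rewrite gt_eqF//; near: x; apply: filterS KG => x [].
by rewrite /=; field; rewrite rx rxa gx.
Unshelve. all: end_near. Qed.
End equivalence_of_asymptotics.

(** * The implications between the assertions on [p] and [phi] *)

Section compound_poisson_density.
Context {R : realType}.
Local Notation mu := (@lebesgue_measure R).

Variables (l : R) (phi : R -> R).
Hypotheses (pphi : prob_density (EFin \o phi)) (sphi : forall x : R, (x < 0)%R -> phi x = 0%R)
  (l0 : (0 < l)%R).

Let f := EFin \o phi.
Let q := cexp l f.
Let p := cp_density l phi.
Let Q : R := (expR l - 1)%R.

Let l0' : (0 <= l)%R. Proof. exact: ltW. Qed.

Lemma causal_density : causal (EFin \o phi).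
Proof. by split; [exact: pphi.1|move=> x x0 /=; rewrite sphi]. Qed.

Let cf : causal f. Proof. exact: causal_density. Qed.
Let f1 : \int[mu]_x f x = 1. Proof. exact: pphi.2. Qed.
Let cq : causal q. Proof. exact: causal_cexp. Qed.
Let qQ : \int[mu]_x q x = Q%:E. Proof. exact: integral_cexp. Qed.
Let Q0 : (0 < Q)%R. Proof. by rewrite subr_gt0 -expR0 ltr_expR. Qed.
Let Qn0 : (Q != 0)%R. Proof. by rewrite gt_eqF. Qed.

Let pE : p = fun x => (Q^-1)%:E * q x. Proof. exact: cp_densityE. Qed.

Let cp : causal p.
Proof. by rewrite pE; apply: causalZ => //; rewrite invr_ge0 ltW. Qed.

Let p1 : \int[mu]_x p x = 1.
Proof.
rewrite pE ge0_integralZl_EFin//.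
- by rewrite qQ -EFinM mulVf.
- by move=> x _; exact: cq.1.2.
- exact: cq.1.1.
- by rewrite invr_ge0 ltW.
Qed.

Let qE : q = fun x => Q%:E * p x.
Proof. by apply/funext => x; rewrite pE muleA -EFinM divff// mul1e. Qed.

Let fconv_qq : fconv q q = fun x => (Q ^+ 2)%:E * fconv p p x.
Proof.
have Q0' := ltW Q0; rewrite {1 2}qE fconvZr//; last 2 first.
- by rewrite -qE; exact: cq.1.
- exact: cp.1.
apply/funext => x; rewrite fconvC; [|by rewrite -qE; exact: cq.1|exact: cp.1].
rewrite fconvZr//; [|exact: cp.1|exact: cp.1].
by rewrite muleA -EFinM -expr2.
Qed.

Let asymp_pq r a : asymp r p a -> asymp r q (Q * a).
Proof. by rewrite qE; exact: asympZ. Qed.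

Let asymp_qp r a : asymp r q a -> asymp r p (a / Q).
Proof. by rewrite mulrC pE; exact: asympZ. Qed.

Let expRE : (1 - expR (- l) = Q / expR l)%R.
Proof. by rewrite expRN /Q; field; rewrite gt_eqF ?expR_gt0. Qed.

Let long_tailed_phi : class_L f -> [/\ long_tailed phi, eventually_pos phi,
  (\forall x \near +oo%R, f x = (phi x)%:E) & asymp phi f 1].
Proof.
move=> /class_L_long_tailed[lf _]; have [_ r0 _] := (lf : long_tailed phi).
by split => //; [exact: nearW|apply: asymp_ref => //; exact: nearW].
Qed.

(** Deconvolution gives [f ~ D q], from which [f] inherits the long tail. Bounding the factors of
    [mid f f] in turn by [q / l] reduces it to [mid q q], negligible by the subexponentiality of
    [p]. *)
Lemma subexp_of_cp_density : class_Sd p -> class_Sd f.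
Proof.
move=> [[_ Lp] pp]; have [lp pfin] := class_L_long_tailed _ Lp.
have [_ rp0 _] := lp.
have ap : asymp (fine \o p) p 1 by exact: asymp_ref.
have aq := asymp_pq _ _ ap; rewrite mulr1 in aq.
have [lq qfin] := long_tailed_asymp _ _ _ lp cq.1 Q0 aq.
have [_ r0 _] := lq.
have rqp : \forall x \near +oo%R, (fine (q x) = Q * fine (p x))%R.
  near=> x; have -> : p x = (fine (p x))%:E by near: x.
  by rewrite qE; have -> : p x = (fine (p x))%:E by near: x.
have app : asymp (fine \o p) (fconv p p) 2.
  by apply: asym_equiv_asymp pp _; rewrite -[X in asymp _ _ X]mulr1; exact: asympZ.
have aqq : asymp (fine \o q) (fconv q q) (2 * Q).
  have := asympZ _ _ (Q ^+ 2)%R _ app; rewrite -fconv_qq.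
  move=> /(asymp_rescale _ (fine \o q) _ _ Q Qn0 rqp).
  by rewrite (_ : Q ^+ 2 * 2 / Q = 2 * Q)%R//; field.
have fa := asymp_deconvolution f l cf f1 l0 lq qfin aqq.
set D := (expR (- l) / l)%R in fa.
have D0 : (0 < D)%R by rewrite divr_gt0// expR_gt0.
have [lf ffin] := long_tailed_asymp _ _ _ lq cf.1 D0 fa.
split; first by split => //; exact: long_tailed_class_L cf.1 lf ffin.
have aq1 : asymp (fine \o q) q 1 by exact: asymp_ref.
have hq : asymp2 (fine \o q) (head q q) Q.
  by rewrite -(mul1r Q); apply: asymp2_head => //; exact: cq.1.
have mqq : asymp2 (fine \o q) (mid q q) 0.
  have := asymp2_mid _ _ _ _ _ _ r0 cq cq hq hq aqq.
  by rewrite (_ : 2 * Q - (Q + Q) = 0)%R//; lra.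
have li0 : (0 <= l^-1)%R by rewrite invr_ge0.
have fq : \forall x \near +oo%R, f x <= (l^-1)%:E * q x.
  apply: nearW => x; have := le_cexp_term l f 0 x l0' cf.
  rewrite /poisson_coef expr1 divr1 => h.
  by rewrite -[leLHS]mul1e -(mulVf (lt0r_neq0 l0)) EFinM -muleA lee_wpmul2l// lee_fin.
have mqf : asymp2 (fine \o q) (mid q f) 0.
  by apply: (mid0_le _ _ _ q l^-1) => //; [exact: cq.1|exact: cf.1|exact: cq.1].
have mff : asymp2 (fine \o q) (mid f f) 0.
  apply: (mid0_le _ _ _ q l^-1) => //; [exact: cf.1|exact: cf.1|exact: cq.1|].
  by apply: asymp2_midC mqf; [exact: cq.1|exact: cf.1].
have hf : asymp2 (fine \o q) (head f f) (D * 1).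
  by apply: asymp2_head => //; exact: cf.1.
have aff := asymp_fconv _ _ _ _ _ _ r0 cf cf hf hf mff.
apply: (asymp_asym_equiv (fine \o q) _ _ (2 * D)%R) => //.
- by rewrite mulr_gt0.
- by move: aff; rewrite (_ : D * 1 + D * 1 + 0 = 2 * D)%R//; lra.
- exact: asympZ.
Unshelve. all: end_near. Qed.

(** [C] is arbitrary at first, but [Q * C = l * expR l] is forced, and the middle range of [f * f]
    that vanishes along the way makes [p] subexponential. *)
Lemma cp_density_coef (C : R) : class_L f -> (0 < C)%R ->
  asym_equiv p (fun x => (C * phi x)%:E) ->
  [/\ asymp phi q (l * expR l), asymp2 phi (mid f f) 0 & class_Sd p].
Proof.
move=> /long_tailed_phi[lphi r0 fphi af] C0 pC.
have Cphi : asymp phi (fun x => (C * phi x)%:E) C.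
  rewrite -[X in asymp _ _ X]mulr1; apply: (asympZ _ f) => //.
have ap := asym_equiv_asymp _ _ _ _ pC Cphi.
have aq := asymp_pq _ _ ap; have QC0 : (0 < Q * C)%R by rewrite mulr_gt0.
have [QCE m0] := asymp_cexp_coef _ _ lphi cf f1 af _ l0 _ QC0 aq.
rewrite QCE in aq QC0; split => //.
split.
  split; first by split; [exact: cp.1|].
  have [lp pfin] := long_tailed_asymp _ _ _ lphi cp.1 C0 ap.
  exact: long_tailed_class_L cp.1 lp pfin.
have aqq := asymp_fconv_cexp _ _ lphi cf f1 af _ l0 _ QC0 aq m0.
have ap' := asymp_qp _ _ aq.
apply: (asymp_asym_equiv phi _ _ (2 * (l * expR l / Q))%R) => //.
- by rewrite mulr_gt0// divr_gt0.
- have := asympZ _ _ (Q ^- 2)%R _ aqq.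
  rewrite fconv_qq (_ : (fun x => _) = fconv p p); last first.
    by apply/funext => x; rewrite muleA -EFinM mulVf ?mul1e// expf_neq0.
  rewrite (_ : Q ^- 2 * (2 * (expR l - 1) * (l * expR l)) = 2 * (l * expR l / Q))%R//.
  by rewrite -/Q; field.
- exact: asympZ.
Qed.

(** Since [(1 - e^(-l)) p = e^(-l) q], the factor [expR l] cancels. *)
Lemma asymp_cp_density : class_L f -> asymp phi q (l * expR l) ->
  asym_equiv (fun x => (1 - expR (- l))%:E * p x) (fun x => (l * phi x)%:E).
Proof.
move=> /long_tailed_phi[lphi r0 fphi af] /asymp_qp /(asympZ _ _ (1 - expR (- l))%R) h.
apply: (asymp_asym_equiv phi _ _ l) => //; last first.
  by rewrite -[X in asymp _ _ X]mulr1; exact: (asympZ _ f).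
move: h; rewrite (_ : (1 - expR (- l)) * (l * expR l / Q) = l)%R//.
by rewrite expRE; field; rewrite Qn0 gt_eqF ?expR_gt0.
Qed.

Lemma asym_equiv_cp_density : class_L f ->
  asym_equiv (fun x => (1 - expR (- l))%:E * p x) (fun x => (l * phi x)%:E) ->
  exists C : R, (0 < C)%R /\ asym_equiv p (fun x => (C * phi x)%:E).
Proof.
move=> /long_tailed_phi[lphi r0 fphi af] pl.
have k0 : (0 < 1 - expR (- l))%R by rewrite expRE divr_gt0 ?expR_gt0.
have lphiE : asymp phi (fun x => (l * phi x)%:E) l.
  by rewrite -[X in asymp _ _ X]mulr1; exact: (asympZ _ f).
have := asympZ _ _ ((1 - expR (- l))^-1)%R _ (asym_equiv_asymp _ _ _ _ pl lphiE).
rewrite (_ : (fun x => _) = p); last first.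
  by apply/funext => x; rewrite muleA -EFinM mulVf ?mul1e// gt_eqF.
set C := (_ * l)%R => pC; exists C.
have C0 : (0 < C)%R by rewrite mulr_gt0// invr_gt0.
split => //; apply: (asymp_asym_equiv phi _ _ C) => //.
by rewrite -[X in asymp _ _ X]mulr1; exact: (asympZ _ f).
Qed.

Lemma asymp_cp_density_L2 :
  \int[mu]_(x in `[0%R, +oo[%classic) ((phi x) ^+ 2)%:E < +oo ->
  class_Sd f -> asymp phi q (l * expR l).
Proof.
move=> L2 [[_ Lf] ff]; have [lphi r0 fphi af] := long_tailed_phi Lf.
have aff : asymp phi (fconv f f) 2.
  by apply: asym_equiv_asymp ff _; rewrite -[X in asymp _ _ X]mulr1; exact: asympZ.
have sqE : \int[mu]_x ((phi x) ^+ 2)%:E =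
    \int[mu]_(x in `[0%R, +oo[%classic) ((phi x) ^+ 2)%:E.
  rewrite [RHS]integral_mkcond; apply: eq_integral => x _ /=; rewrite patchE.
  case: ifPn => //; rewrite notin_setE /= in_itv/= andbT => /negP; rewrite -ltNge => x0.
  by rewrite sphi// expr0n.
have sq_fin : \int[mu]_x ((phi x) ^+ 2)%:E \is a fin_num.
  rewrite ge0_fin_numE ?sqE//; apply: integral_ge0 => x _.
  by rewrite lee_fin sqr_ge0.
have ffM x : fconv f f x <= (fine (\int[mu]_x ((phi x) ^+ 2)%:E))%:E.
  by rewrite fineK//; apply: fconv_square_le; exact: cf.1.
have m0 := asymp_mid_subexp _ _ lphi cf f1 af aff.
have [k [k0 qk]] := cexp_bound _ _ _ lphi cf f1 fphi aff ffM l l0'.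
exact: (asymp_cexp_of_bound _ _ lphi cf f1 af _ l0 _ m0 k0 qk).
Qed.
End compound_poisson_density.

Theorem theorem1p1 (R : realType) (lambda : R) (phi : R -> R)
    (nu : {measure set (measurableTypeR R) -> \bar R})
    (mu : probability (measurableTypeR R) R)
    (phi_density : prob_density (EFin \o phi))
    (phi_supp : forall x : R, (x < 0)%R -> phi x = 0%R)
    (lambda_gt0 : (0 < lambda)%R)
    (nuE : forall A : set (measurableTypeR R), measurable A ->
       nu A = ac_measure (fun x : R => (lambda * phi x)%:E) A)
    (lambdaE : nu `]0%R, +oo[%classic = lambda%:E)
    (muE : forall A : set (measurableTypeR R), measurable A ->
       mu A = compound_poisson lambda phi A) :
  let p : R -> \bar R := cp_density lambda phi in
  let a := class_Sd p in
  let b := class_Sd (EFin \o phi) in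
  let c := class_Ld (EFin \o phi) /\
    asym_equiv (fun x : R => (1 - expR (- lambda))%:E * p x)
               (fun x : R => (lambda * phi x)%:E) in
  let d := class_Ld (EFin \o phi) /\
    exists C : R, (0 < C)%R /\ asym_equiv p (fun x : R => (C * phi x)%:E) in
  let phi_sq_integrable :=
    \int[@lebesgue_measure R]_(x in `[0%R, +oo[%classic) ((phi x) ^+ 2)%:E < +oo in
  (forall A : set (measurableTypeR R), measurable A ->
     mu A = (expR (- lambda))%:E * \d_(0%R : measurableTypeR R) A
            + (1 - expR (- lambda))%:E * ac_measure p A) /\
  (* (i) *) (a -> b) /\
  (* (ii) *) ((c <-> d) /\ (c -> a)) /\
  (* (iii) *) (phi_sq_integrable ->
     (b -> c) /\ ((a <-> b) /\ (b <-> c) /\ (c <-> d))).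
Proof.
move=> p a b c d L2.
have cphi : causal (EFin \o phi) by exact: causal_density.
have ab : a -> b by exact: subexp_of_cp_density.
have cd : c -> d.
  by move=> [Lphi pc]; split => //; apply: asym_equiv_cp_density => //; case: Lphi.
(* Forcing the constant gives (c) and the vanishing middle range gives (a), both from one argument;
   (c) reaches (a) through (d). *)
have dac : d -> a /\ c.
  move=> [Lphi [C [C0 pC]]].
  have [aq _ Sp] := cp_density_coef _ _ phi_density phi_supp lambda_gt0 C Lphi.2 C0 pC.
  by split => //; split => //; apply: asymp_cp_density => //; exact: Lphi.2.
have ca : c -> a by move=> /cd/dac[].
have dc : d -> c by move=> /dac[].
split; first by move=> A mA; rewrite muE// compound_poissonE.
split => //; split => // L2fin.
have bc : b -> c.
  move=> Sphi; split; first by case: Sphi.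
  by apply: asymp_cp_density => //; [case: Sphi => -[]|exact: asymp_cp_density_L2].
by split => //; tauto.
Qed.
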